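(* Let $(M,g)$ be a closed Riemannian manifold with base point $\mathbf{x}_0\in M$ and let $1\le p<\infty$. Then the cocone $(L^{p}(\mathcal{C}_{\mathbf{x}_{0}}(M),\mu_{\mathbf{x}_{0}}),\phi_{\mathcal{T}})_{\mathcal{T}\in\mathcal{P}}$ is a realization of the colimit, in the category $\mathfrak{Ban}$, of the diagram $(L^{p}(M^{\mathcal{T}},\mu^{\mathcal{T}}_{\mathbf{x}_{0}}),\pi^{\ast}_{\mathcal{T}\mathcal{T}'})$ indexed by the directed set $\mathcal{P}$.
   Context: Closed Riemannian manifold means compact connected Riemannian manifold (without boundary). $\mu$ is the Riemannian volume measure on the Borel $\sigma$-algebra $\mathcal{B}_M$ of $M$, and $p_t(x,y)$ ($t>0$, $x,y\in M$) is the heat kernel, i.e. the Schwartz kernel of $e^{t\Delta}$ on $L^2(M,\mu)$, with $\Delta$ the Laplace-Beltrami operator. $\mathcal{C}_{\mathbf{x}_0}(M)$ is the space of continuous paths $\gamma:[0,1]\to M$ with $\gamma(0)=\mathbf{x}_0$, with the Borel $\sigma$-algebra of the uniform topology. The Wiener measure $\mu_{\mathbf{x}_0}$ is the probability measure on $\mathcal{C}_{\mathbf{x}_0}(M)$ characterized by $$\mu_{\mathbf{x}_0}\big(\{\gamma:\gamma(t_i)\in B_i,\ 1\le i\le n\}\big)=\int_{B_1}\cdots\int_{B_n}\prod_{i=1}^n p_{t_i-t_{i-1}}(x_i,x_{i-1})\prod_{i=1}^n d\mu(x_i),\quad x_0=\mathbf{x}_0,$$ for all $0=t_0<t_1<\cdots<t_n\le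 1$ and $B_1,\dots,B_n\in\mathcal{B}_M$. $\mathcal{P}$ is the set of finite partitions $\mathcal{T}=\{0=t_0<t_1<\cdots<t_n\}\subset[0,1]$, directed by inclusion. For $\mathcal{T}\in\mathcal{P}$, $M^{\mathcal{T}}:=\prod_{t\in\mathcal{T}\setminus\{0\}}M$ with the product $\sigma$-algebra and the probability measure $d\mu_{\mathbf{x}_0}^{\mathcal{T}}=\prod_{i=1}^{n}p_{t_i-t_{i-1}}(x_{t_i},x_{t_{i-1}})\prod_{i=1}^n d\mu(x_{t_i})$, $x_{t_0}=\mathbf{x}_0$. For $\mathcal{T}\subset\mathcal{T}'$, $\pi_{\mathcal{T}\mathcal{T}'}:M^{\mathcal{T}'}\to M^{\mathcal{T}}$ is the coordinate projection $(x_t)_{t\in\mathcal{T}'\setminus\{0\}}\mapsto(x_t)_{t\in\mathcal{T}\setminus\{0\}}$, and $\pi^{\ast}_{\mathcal{T}\mathcal{T}'}:L^p(M^{\mathcal{T}},\mu^{\mathcal{T}}_{\mathbf{x}_0})\to L^p(M^{\mathcal{T}'},\mu^{\mathcal{T}'}_{\mathbf{x}_0})$, $f\mapsto f\circ\pi_{\mathcal{T}\mathcal{T}'}$, is the induced linear isometry. Let $\pi_{\mathcal{T}}(\gamma):=(\gamma(t))_{t\in\mathcal{T}\setminus\{0\}}$ and $$\phi_{\mathcal{T}}:L^p(M^{\mathcal{T}},\mu^{\mathcal{T}}_{\mathbf{x}_0})\to L^p(\mathcal{C}_{\mathbf{x}_0}(M),\mu_{\mathbf{x}_0}),\quad \phi_{\mathcal{T}}(f):=f\circ\pi_{\mathcal{T}}|_{\mathcal{C}_{\mathbf{x}_0}(M)}.$$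 $\mathfrak{Ban}$ is the category whose objects are Banach spaces and whose morphisms are linear isometries (not necessarily surjective). For a diagram $(X_i,\varphi_{ij})$ in $\mathfrak{Ban}$ indexed by a directed set $I$ (so $\varphi_{ii}=\mathrm{id}$, $\varphi_{ik}=\varphi_{jk}\circ\varphi_{ij}$ for $i\le j\le k$), a cocone is a pair $(X,\phi_i)$ with $X$ an object and $\phi_i:X_i\to X$ morphisms such that $\phi_i=\phi_j\circ\varphi_{ij}$ for $i\le j$. A cocone $(L,\psi_i)$ is (a realization of) the colimit if for every cocone $(X,\phi_i)$ there is a unique morphism $\varphi_X:L\to X$ with $\varphi_X\circ\psi_i=\phi_i$ for all $i$. *)

(* Defs.v *)
From HB Require Import structures.
From mathcomp Require Import all_boot all_order all_algebra generic_quotient.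
From mathcomp Require Import all_classical all_reals all_analysis.
From mathcomp Require Import measurable_realfun lra.

Set Implicit Arguments.
Unset Strict Implicit.
Unset Printing Implicit Defensive.

Import Order.TTheory GRing.Theory Num.Theory.
Import numFieldNormedType.Exports.

Local Open Scope classical_set_scope.
Local Open Scope ring_scope.

(* [LspaceType] is the quotient of the measurable functions of finite Lp-norm by
   almost everywhere equality, but the library gives it no algebraic structure.
   [Lp] is an alias for finite p; it is made a Banach space below. *)
Section Lp.
Context {d} {T : measurableType d} {R : realType}.
Local Notation "''N[' mu ]_ p [ F ]" := (Lnorm mu p F).
Variable mu : {measure set T -> \bar R}.

Lemma lee1_fin (p : R) : 1 <= p -> (1 <= p%:E)%E.
Proof. by rewrite lee_fin. Qed.

Definition Lp (p : R) (p1 : 1 <= p) : Type := LspaceType mu (lee1_fin p1).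

Variables (p : R) (p1 : 1 <= p).
Local Notation LpT := (Lp p1).

Definition Lp_fun (F : LpT) : T -> R := (F : LspaceType _ _).
Coercion Lp_fun : Lp >-> Funclass.

Let p0 : p != 0. Proof. by rewrite gt_eqF// (lt_le_trans ltr01). Qed.
Let pge0 : 0 <= p. Proof. by rewrite (le_trans ler01). Qed.

Lemma measurable_Lp (F : LpT) : measurable_fun setT (F : T -> R).
Proof. exact: (@measurable_funPT _ _ _ _ (repr (F : {mfun_ mu, T >-> measurableTypeR R}))). Qed.

Lemma LnormE (f : T -> R) :
  'N[mu]_p%:E[EFin \o f] = ((\int[mu]_x (`|f x| `^ p)%:E) `^ p^-1)%E.
Proof. by rewrite unlock. Qed.

Lemma measurable_powR_norm (f : T -> R) : measurable_fun setT f ->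
  measurable_fun setT (fun x => (`|f x| `^ p)%:E).
Proof.
move=> mf; apply/measurable_EFinP.
by apply: (@measurableT_comp _ _ _ _ _ _ (@powR R ^~ p)) => //;
  exact: measurableT_comp.
Qed.

Lemma Lnorm_ae_eq (f g : T -> R) : measurable_fun setT f ->
  measurable_fun setT g -> f = g %[ae mu] ->
  'N[mu]_p%:E[EFin \o f] = 'N[mu]_p%:E[EFin \o g].
Proof.
move=> mf mg fg; rewrite !LnormE; congr poweR.
apply: ae_eq_integral => //; [exact: measurable_powR_norm..|].
by apply: filterS fg => x /(_ I) -> _.
Qed.

Lemma finite_norm_Lp (F : LpT) : finite_norm mu p%:E F.
Proof. exact: Lebesgue_finite. Qed.

Lemma ae_eq_Lp (F G : LpT) : (F : T -> R) = G %[ae mu] -> F = G.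
Proof.
case: F => F [[/= hF]]; case: G => G [[/= hG]] FG.
have e : F = G.
  by rewrite -[F]reprK -[G]reprK; exact/eqmodP/asboolP.
move: hF FG; rewrite e => hF FG.
by rewrite (Prop_irrelevance hF hG).
Qed.

Definition ae_class (f : {mfun T >-> measurableTypeR R}) : {mfun_ mu, T >-> measurableTypeR R} :=
  (\pi f)%qT.

Lemma ae_classE (f : {mfun T >-> measurableTypeR R}) :
  (ae_class f : T -> R) = f %[ae mu].
Proof.
have /eqmodP/asboolP : (repr (ae_class f) = f %[mod {mfun_ mu, T >-> measurableTypeR R}])%qT.
  by rewrite reprK.
by [].
Qed.

Definition mfunR (f : T -> R) (mf : measurable_fun setT f) :
  {mfun T >-> measurableTypeR R} :=
  MeasurableFun.Pack (MeasurableFun.Class (@isMeasurableFun.Build _ _ T (measurableTypeR R) f mf)).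

Lemma finite_ae_class (f : T -> R) (mf : measurable_fun setT f) :
  finite_norm mu p%:E f -> finite_norm mu p%:E (ae_class (mfunR mf)).
Proof.
rewrite /finite_norm => lf.
rewrite (@Lnorm_ae_eq _ f)//; last exact: ae_classE.
exact: (@measurable_funPT _ _ _ _ (repr (ae_class (mfunR mf)))).
Qed.

Definition Lp_class (f : T -> R) (mf : measurable_fun setT f)
    (lf : finite_norm mu p%:E f) : LpT :=
  LebesgueSpace.Pack (LebesgueSpace.Class
    (@isFinLebesgue.Build _ _ _ _ _ (lee1_fin p1) (ae_class (mfunR mf))
       (finite_ae_class mf lf))).

Lemma Lp_classE (f : T -> R) mf lf :
  (@Lp_class f mf lf : T -> R) = f %[ae mu].
Proof. exact: (ae_classE (mfunR mf)). Qed.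

Lemma measurable_LpD (F G : LpT) : measurable_fun setT (fun x => F x + G x).
Proof. by apply: measurable_funD; exact: measurable_Lp. Qed.

Lemma measurable_LpZ a (F : LpT) : measurable_fun setT (fun x => a * F x).
Proof. by apply: measurable_funM => //; exact: measurable_Lp. Qed.

Lemma finite_normD (f g : T -> R) :
  measurable_fun setT f -> measurable_fun setT g ->
  finite_norm mu p%:E f -> finite_norm mu p%:E g ->
  finite_norm mu p%:E (fun x => f x + g x).
Proof.
rewrite /finite_norm => mf mg lf lg.
apply: (le_lt_trans (eminkowski mu mf mg (lee1_fin p1))).
exact: lte_add_pinfty.
Qed.

Lemma LnormZl (f : T -> R) a : measurable_fun setT f ->
  'N[mu]_p%:E[EFin \o (fun x => a * f x)] =
  (`|a|%:E * 'N[mu]_p%:E[EFin \o f])%E.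
Proof.
move=> mf; rewrite !LnormE.
under eq_integral do rewrite normrM powRM// EFinM.
rewrite ge0_integralZl//; last exact: measurable_powR_norm.
rewrite poweRM ?lee_fin ?powR_ge0//; last first.
  by apply: integral_ge0 => x _; rewrite lee_fin powR_ge0.
by rewrite poweR_EFin -powRrM mulfV// powRr1.
Qed.

Lemma finite_normZ a (f : T -> R) :
  measurable_fun setT f -> finite_norm mu p%:E f ->
  finite_norm mu p%:E (fun x => a * f x).
Proof.
rewrite /finite_norm => mf lf; rewrite LnormZl//.
by rewrite lte_mul_pinfty.
Qed.

Definition Lp_zero : LpT :=
  @Lp_class (cst 0) (measurable_cst _) (finite_norm_cst0 mu (lee1_fin p1)).

Definition Lp_add (F G : LpT) : LpT := Lp_class (measurable_LpD F G)
  (finite_normD (measurable_Lp F) (measurable_Lp G)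
                (finite_norm_Lp F) (finite_norm_Lp G)).

Definition Lp_scale (a : R) (F : LpT) : LpT := Lp_class (measurable_LpZ a F)
  (finite_normZ a (measurable_Lp F) (finite_norm_Lp F)).

Definition Lp_opp : LpT -> LpT := Lp_scale (-1).

Lemma Lp_addE F G : (Lp_add F G : T -> R) = (fun x => F x + G x) %[ae mu].
Proof. exact: Lp_classE. Qed.
Lemma Lp_scaleE a F : (Lp_scale a F : T -> R) = (fun x => a * F x) %[ae mu].
Proof. exact: Lp_classE. Qed.
Lemma Lp_oppE F : (Lp_opp F : T -> R) = (fun x => - F x) %[ae mu].
Proof.
by apply: filterS (Lp_scaleE (-1) F) => x /[apply] ->; rewrite mulN1r.
Qed.
Lemma Lp_zeroE : (Lp_zero : T -> R) = cst 0 %[ae mu].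
Proof. exact: Lp_classE. Qed.

Lemma Lp_addA : associative Lp_add.
Proof.
move=> F G H; apply: ae_eq_Lp.
apply: (filter_app _ _ (Lp_addE F G)).
apply: (filter_app _ _ (Lp_addE (Lp_add F G) H)).
apply: (filter_app _ _ (Lp_addE G H)).
apply: (filter_app _ _ (Lp_addE F (Lp_add G H))).
apply: filterE => x; move=> /(_ I)-> /(_ I)-> /(_ I)-> /(_ I)-> _; exact: addrA.
Qed.

Lemma Lp_addC : commutative Lp_add.
Proof.
move=> F G; apply: ae_eq_Lp.
apply: (filter_app _ _ (Lp_addE G F)).
apply: (filter_app _ _ (Lp_addE F G)).
apply: filterE => x; move=> /(_ I)-> /(_ I)-> _.
exact: addrC.
Qed.

Lemma Lp_add0 : left_id Lp_zero Lp_add.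
Proof.
move=> F; apply: ae_eq_Lp.
apply: (filter_app _ _ (Lp_zeroE)).
apply: (filter_app _ _ (Lp_addE Lp_zero F)).
apply: filterE => x; move=> /(_ I)-> /(_ I)-> _.
exact: add0r.
Qed.

Lemma Lp_addN : left_inverse Lp_zero Lp_opp Lp_add.
Proof.
move=> F; apply: ae_eq_Lp.
apply: (filter_app _ _ (Lp_zeroE)).
apply: (filter_app _ _ (Lp_oppE F)).
apply: (filter_app _ _ (Lp_addE (Lp_opp F) F)).
apply: filterE => x; move=> /(_ I)-> /(_ I)-> /(_ I)-> _.
exact: addNr.
Qed.

Lemma Lp_scaleA a b F : Lp_scale a (Lp_scale b F) = Lp_scale (a * b) F.
Proof.
apply: ae_eq_Lp.
apply: (filter_app _ _ (Lp_scaleE (a * b) F)).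
apply: (filter_app _ _ (Lp_scaleE b F)).
apply: (filter_app _ _ (Lp_scaleE a (Lp_scale b F))).
apply: filterE => x; move=> /(_ I)-> /(_ I)-> /(_ I)-> _.
exact: mulrA.
Qed.

Lemma Lp_scale1 : left_id 1 Lp_scale.
Proof.
move=> F; apply: ae_eq_Lp.
apply: (filter_app _ _ (Lp_scaleE 1 F)).
apply: filterE => x; move=> /(_ I)-> _; exact: mul1r.
Qed.

Lemma Lp_scaleDr : right_distributive Lp_scale Lp_add.
Proof.
move=> a F G; apply: ae_eq_Lp.
apply: (filter_app _ _ (Lp_scaleE a G)).
apply: (filter_app _ _ (Lp_scaleE a F)).
apply: (filter_app _ _ (Lp_addE (Lp_scale a F) (Lp_scale a G))).
apply: (filter_app _ _ (Lp_addE F G)).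
apply: (filter_app _ _ (Lp_scaleE a (Lp_add F G))).
apply: filterE => x; move=> /(_ I)-> /(_ I)-> /(_ I)-> /(_ I)-> /(_ I)-> _.
exact: mulrDr.
Qed.

Lemma Lp_scaleDl F a b : Lp_scale (a + b) F = Lp_add (Lp_scale a F) (Lp_scale b F).
Proof.
apply: ae_eq_Lp.
apply: (filter_app _ _ (Lp_scaleE b F)).
apply: (filter_app _ _ (Lp_scaleE a F)).
apply: (filter_app _ _ (Lp_addE (Lp_scale a F) (Lp_scale b F))).
apply: (filter_app _ _ (Lp_scaleE (a + b) F)).
apply: filterE => x; move=> /(_ I)-> /(_ I)-> /(_ I)-> /(_ I)-> _.
exact: mulrDl.
Qed.

Definition Lp_norm (F : LpT) : R := fine 'N[mu]_p%:E[EFin \o F].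

Lemma Lp_normE (F : LpT) : (Lp_norm F)%:E = 'N[mu]_p%:E[EFin \o F].
Proof.
by rewrite fineK// ge0_fin_numE ?Lnorm_ge0//; exact: finite_norm_Lp.
Qed.

Lemma Lnorm_class f mf lf :
  'N[mu]_p%:E[EFin \o (@Lp_class f mf lf)] = 'N[mu]_p%:E[EFin \o f].
Proof.
by apply: Lnorm_ae_eq => //; [exact: measurable_Lp|exact: Lp_classE].
Qed.

Lemma Lp_normD F G : Lp_norm (Lp_add F G) <= Lp_norm F + Lp_norm G.
Proof.
rewrite -lee_fin EFinD !Lp_normE Lnorm_class.
exact: (eminkowski mu (measurable_Lp F) (measurable_Lp G) (lee1_fin p1)).
Qed.

Lemma Lp_normZ a F : Lp_norm (Lp_scale a F) = `|a| * Lp_norm F.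
Proof.
apply: EFin_inj; rewrite EFinM !Lp_normE Lnorm_class LnormZl//.
exact: measurable_Lp.
Qed.

Lemma Lp_norm0_eq0 F : Lp_norm F = 0 -> F = Lp_zero.
Proof.
move=> F0; have {}F0 : (Lp_norm F)%:E = 0%E by rewrite F0.
rewrite Lp_normE in F0; apply: ae_eq_Lp.
have : ae_eq mu setT (EFin \o F) (cst 0%E).
  apply: (@Lnorm_eq0_eq0 _ _ _ _ _ p%:E) => //.
    by apply/measurable_EFinP; exact: measurable_Lp.
  by rewrite lte_fin (lt_le_trans ltr01).
move=> F0'; apply: (filter_app _ _ (Lp_zeroE)).
apply: (filter_app _ _ (F0')).
apply: filterE => x /(_ I) FE /(_ I) ->.
by move=> _; case: FE.
Qed.

HB.instance Definition _ := gen_eqMixin LpT.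
HB.instance Definition _ := gen_choiceMixin LpT.
HB.instance Definition _ := GRing.isZmodule.Build LpT
  Lp_addA Lp_addC Lp_add0 Lp_addN.
HB.instance Definition _ := GRing.Zmodule_isLmodule.Build R LpT
  Lp_scaleA Lp_scale1 Lp_scaleDr Lp_scaleDl.
HB.instance Definition _ := Lmodule_isNormed.Build R LpT
  Lp_normD Lp_normZ Lp_norm0_eq0.

End Lp.

Section Lp_complete.
Context {d} {T : measurableType d} {R : realType}.
Local Notation "''N[' mu ]_ p [ F ]" := (Lnorm mu p F).
Variable mu : {measure set T -> \bar R}.
Variables (p : R) (p1 : 1 <= p).
Local Notation LpT := (Lp mu p1).

Let p0 : p != 0. Proof. by rewrite gt_eqF// (lt_le_trans ltr01). Qed.
Let pge0 : 0 <= p. Proof. by rewrite (le_trans ler01). Qed.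

Lemma Lnorm_leP (f : T -> R) (c : R) : 0 <= c ->
  ('N[mu]_p%:E[EFin \o f] <= c%:E)%E <->
  (\int[mu]_x (`|f x| `^ p)%:E <= (c `^ p)%:E)%E.
Proof.
move=> c0; rewrite LnormE.
have i0 : (0 <= \int[mu]_x (`|f x| `^ p)%:E)%E.
  by apply: integral_ge0 => x _; rewrite lee_fin powR_ge0.
split=> h.
  rewrite -(@poweRe1 _ (integral _ _ _))// -(mulVf p0) poweRrM -poweR_EFin.
  apply: (gt0_ler_poweR pge0) => //.
    by rewrite in_itv/= leey andbT poweR_ge0.
  by rewrite in_itv/= leey andbT lee_fin.
have -> : c%:E = ((c `^ p)%:E `^ p^-1)%E.
  by rewrite poweR_EFin -powRrM mulfV// powRr1.
apply: gt0_ler_poweR => //; first by rewrite invr_ge0.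
  by rewrite in_itv/= leey andbT.
by rewrite in_itv/= leey andbT lee_fin powR_ge0.
Qed.

Lemma Lp_normrE (F : LpT) : `|F|%:E = 'N[mu]_p%:E[EFin \o F].
Proof. exact: Lp_normE. Qed.

Lemma LpBE (F G : LpT) : (F - G : T -> R) = (fun x => F x - G x) %[ae mu].
Proof.
apply: (filter_app _ _ (Lp_addE F (- G))).
apply: (filter_app _ _ (Lp_oppE G)).
by apply: filterE => x /(_ I) + /(_ I) + _ => <- <-.
Qed.

Lemma Lp_normB (F G : LpT) :
  `|F - G|%:E = 'N[mu]_p%:E[EFin \o (fun x => F x - G x)].
Proof.
rewrite Lp_normrE; apply: Lnorm_ae_eq => //; last exact: LpBE.
  exact: measurable_Lp.
by apply: measurable_funB; exact: measurable_Lp.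
Qed.

Lemma cvg_powR (y : R^nat) (l : R) : (forall n, 0 <= y n) ->
  y n @[n --> \oo] --> l -> (y n `^ p) @[n --> \oo] --> l `^ p.
Proof.
move=> y0 yl.
have l0 : 0 <= l.
  rewrite -(cvg_lim _ yl)//; apply: limr_ge; first by apply: cvgP yl.
  exact: nearW.
have [l0E|lneq0] := eqVneq l 0.
  rewrite l0E powR0//; rewrite {}l0E in yl.
  apply: (@squeeze_cvgr _ _ _ _ (cst 0) y) => //; last exact: cvg_cst.
  near=> n; rewrite powR_ge0/=.
  have [->|yn0] := eqVneq (y n) 0; first by rewrite powR0.
  rewrite ge1r_powR// lt0r yn0 y0/=.
  rewrite -[y n]ger0_norm// ltW//.
  near: n; move/cvgrPdist_lt : yl => /(_ 1 ltr01).
  by apply: filterS => n; rewrite sub0r normrN.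
have lgt0 : 0 < l by rewrite lt0r lneq0.
rewrite /powR (negbTE lneq0).
apply: (@cvg_trans _ (expR (p * ln (y n)) @[n --> \oo])).
  apply: near_eq_cvg; near=> n; rewrite gt_eqF//.
  near: n; exact: (cvgr_gt l).
apply: continuous_cvg; first exact: continuous_expR.
apply: cvgM; first exact: cvg_cst.
by apply: continuous_cvg => //; exact: continuous_ln.
Unshelve. all: by end_near. Qed.

Section fast_cauchy.
Variable u : nat -> LpT.
Hypothesis fast_u : forall n, `|u n.+1 - u n| <= 2^-1 ^+ n.

Let f n : T -> R := u n.
Let mf n : measurable_fun setT (f n). Proof. exact: measurable_Lp. Qed.

Let D n x : R := `|f n.+1 x - f n x|.
Let s n x : R := \sum_(0 <= k < n) D k x.

Let mD n : measurable_fun setT (D n).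
Proof. by apply: measurableT_comp => //; exact: measurable_funB. Qed.

Let ms n : measurable_fun setT (s n).
Proof. by apply: measurable_sum => k; exact: mD. Qed.

Let s0 n x : 0 <= s n x.
Proof. by apply: sumr_ge0 => k _; exact: normr_ge0. Qed.

Let geom n : \sum_(k < n) (2^-1 : R) ^+ k <= 2.
Proof.
elim: n => [|n ih]; first by rewrite big_ord0.
rewrite big_ord_recl expr0.
under eq_bigr do rewrite exprS.
rewrite -mulr_sumr -lerBrDl (le_trans (ler_wpM2l _ ih))//.
by rewrite mulVf// -[X in X - _]/(1 + 1) addrK.
Qed.

Let sN n : ('N[mu]_p%:E[EFin \o s n] <= (\sum_(k < n) (2^-1 : R) ^+ k)%:E)%E.
Proof.
elim: n => [|n ih].
  rewrite big_ord0.
  have -> : s 0%N = cst 0 by apply/funext => x; rewrite /s big_geq.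
  by rewrite Lnorm0.
have -> : s n.+1 = (s n \+ D n)%R.
  by apply/funext => x; rewrite /s big_nat_recr.
apply: (le_trans (eminkowski mu (ms n) (mD n) (lee1_fin p1))).
rewrite big_ord_recr/= EFinD leeD//.
rewrite (le_trans _ (_ : (`|u n.+1 - u n|%:E <= _)%E)) ?lee_fin//.
rewrite Lp_normB !LnormE.
by under eq_integral do rewrite normr_id.
Qed.

Let g x := limn (fun n => (s n x `^ p)%:E).

Let nd_s x : {homo (fun n => (s n x `^ p)%:E) : m n / (m <= n)%N >-> (m <= n)%E}.
Proof.
move=> m n mn; rewrite lee_fin ge0_ler_powR// ?nnegrE ?s0//.
have := @nondecreasing_series _ (fun k => D k x) xpredT 0%N.
by apply=> // k _ _; exact: normr_ge0.
Qed.

Let int_g : (\int[mu]_x g x <= (2 `^ p)%:E)%E.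
Proof.
have mp n : measurable_fun setT (fun x => (s n x `^ p)%:E).
  apply/measurable_EFinP.
  by apply: (@measurableT_comp _ _ _ _ _ _ (@powR R ^~ p)).
have ge0p n x : setT x -> (0 <= (s n x `^ p)%:E)%E.
  by move=> _; rewrite lee_fin powR_ge0.
have ndp x : setT x ->
    {homo (fun n => (s n x `^ p)%:E) : m n / (m <= n)%N >-> (m <= n)%E}.
  by move=> _; exact: nd_s.
rewrite (monotone_convergence mu measurableT mp ge0p ndp).
apply: lime_le.
  apply: ereal_nondecreasing_is_cvgn => m n mn; apply: ge0_le_integral => //;
    [exact: ge0p..|by move=> x _; exact: nd_s].
apply: nearW => n.
under eq_integral do rewrite -[s n _]ger0_norm//.
apply/Lnorm_leP => //; apply: (le_trans (sN n)).
by rewrite lee_fin.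
Qed.

Let mg : measurable_fun setT g.
Proof.
apply: (@emeasurable_fun_cvg _ _ _ _ (fun n x => (s n x `^ p)%:E)).
  move=> n; apply/measurable_EFinP.
  by apply: (@measurableT_comp _ _ _ _ _ _ (@powR R ^~ p)).
by move=> x _; apply: ereal_nondecreasing_is_cvgn; exact: nd_s.
Qed.

Let g_ge n x : ((s n x `^ p)%:E <= g x)%E.
Proof.
apply: lime_ge; first by apply: ereal_nondecreasing_is_cvgn; exact: nd_s.
by exists n => // m /= nm; exact: nd_s.
Qed.

Let g_fin : {ae mu, forall x, g x \is a fin_num}.
Proof.
have : mu.-integrable setT g.
  apply/integrableP; split=> //.
  under eq_integral => x _.
    rewrite gee0_abs; last by rewrite (le_trans _ (g_ge 0 x))// lee_fin powR_ge0.
    over.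
  by rewrite (le_lt_trans int_g)// ltry.
move/(integrable_ae measurableT).
by apply: filterS => x; exact.
Qed.

Let cvg_f : {ae mu, forall x, cvgn (fun n => f n x)}.
Proof.
apply: filterS g_fin => x gx.
have bs n : s n x <= fine (g x) `^ p^-1.
  have := g_ge n x; rewrite -(fineK gx) lee_fin => h.
  rewrite -[s n x]powRr1// -(mulfV p0) powRrM ge0_ler_powR ?invr_ge0//.
    by rewrite nnegrE powR_ge0.
  by rewrite nnegrE (le_trans _ h)// powR_ge0.
have : cvgn (series (fun k => f k.+1 x - f k x)).
  apply: (@normed_cvg R R^o); apply: nondecreasing_is_cvgn.
    by apply: nondecreasing_series => k _ _; exact: normr_ge0.
  by exists (fine (g x) `^ p^-1) => _ [n _ <-]; exact: bs.
move=> /cvg_ex[l hl]; apply/cvg_ex; exists (l + f 0%N x).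
have -> : (fun n => f n x) = (fun n => series (fun k => f k.+1 x - f k x) n + f 0%N x).
  by apply/funext => n; rewrite /series/= telescope_sumr// subrK.
by apply: cvgD => //; exact: cvg_cst.
Qed.

Let h x := limn_esup (fun n => (f n x)%:E).
Let f_oo x : R := fine (h x).

Let mf_oo : measurable_fun setT f_oo.
Proof.
apply: measurableT_comp => //; apply: measurable_fun_limn_esup => n.
exact/measurable_EFinP.
Qed.

Let cvg_f_oo : {ae mu, forall x, f n x @[n --> \oo] --> f_oo x}.
Proof.
apply: filterS cvg_f => x /cvg_ex[l fl].
suff -> : f_oo x = l by [].
rewrite /f_oo /h.
have fl' : (f n x)%:E @[n --> \oo] --> l%:E by apply/fine_cvgP; split => //; exact: nearW.
rewrite is_cvg_limn_esupE; last by apply/cvg_ex; exists l%:E.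
by rewrite (cvg_lim _ fl').
Qed.

Let dist_u m k : `|u (m + k)%N - u m| <= 2 * 2^-1 ^+ m.
Proof.
suff : `|u (m + k)%N - u m| <= 2^-1 ^+ m * \sum_(i < k) (2^-1 : R) ^+ i.
  move=> /le_trans; apply; rewrite mulrC ler_wpM2r//.
elim: k => [|k ih]; first by rewrite addn0 subrr normr0 big_ord0 mulr0.
rewrite big_ord_recr/= mulrDr -exprD addnS.
rewrite (le_trans (ler_distD (u (m + k)%N) _ _))// addrC lerD//.
Qed.

Lemma fast_cauchy_cvg : exists G : LpT, forall n, `|G - u n| <= 2 * 2^-1 ^+ n.
Proof.
have key m : ('N[mu]_p%:E[EFin \o (fun x => f_oo x - f m x)%R]
    <= (2 * 2^-1 ^+ m)%:E)%E.
  apply/Lnorm_leP; first by rewrite mulr_ge0// exprn_ge0.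
  have mfm n : measurable_fun setT (fun x => (`|f n x - f m x| `^ p)%:E).
    by apply: measurable_powR_norm => //; exact: measurable_funB.
  rewrite (_ : integral _ _ _ =
      \int[mu]_x limn_einf (fun n => (`|f n x - f m x| `^ p)%:E))%E; last first.
    apply: ae_eq_integral => //.
    - by apply: measurable_powR_norm => //; exact: measurable_funB.
    - rewrite (_ : (fun x => _) =
          (fun x => - limn_esup (fun n => - (`|f n x - f m x| `^ p)%:E))%E).
        apply: measurableT_comp => //; apply: measurable_fun_limn_esup => n.
        exact: measurableT_comp.
      apply/funext => x; rewrite -limn_einfN; congr limn_einf.
      by apply/funext => n; rewrite /comp oppeK.
    - apply: filterS cvg_f_oo => x fx _.
      have cf : (`|f n x - f m x| `^ p)%:E @[n --> \oo] --> (`|f_oo x - f m x| `^ p)%:E.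
        apply/fine_cvgP; split; first exact: nearW.
        apply: cvg_powR => //; apply: cvg_norm.
        by apply: cvgB => //; exact: cvg_cst.
      rewrite is_cvg_limn_einfE; last by apply/cvg_ex; eexists; exact: cf.
      by rewrite (cvg_lim _ cf).
  apply: (le_trans (fatou _ _ _ _)) => //.
  rewrite limn_einf_lim; apply: lime_le; first exact: is_cvg_einfs.
  apply: nearW => n.
  rewrite (@le_trans _ _ (\int[mu]_x (`|f (m + n)%N x - f m x| `^ p)%:E)%E)//.
    apply: ereal_inf_lbound; exists (m + n)%N => //=; exact: leq_addl.
  apply/Lnorm_leP; first by rewrite mulr_ge0// exprn_ge0.
  by rewrite -Lp_normB lee_fin.
have lf_oo : finite_norm mu p%:E f_oo.
  rewrite (_ : f_oo = (fun x => (f_oo x - f 0%N x) + f 0%N x)); last first.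
    by apply/funext => x; rewrite subrK.
  apply: finite_normD => //.
  - exact: measurable_funB.
  - by rewrite /finite_norm (le_lt_trans (key 0%N))// ltry.
  - exact: finite_norm_Lp.
exists (Lp_class p1 mf_oo lf_oo) => n.
rewrite -lee_fin Lp_normB (le_trans _ (key n))//.
rewrite le_eqVlt; apply/orP; left; apply/eqP.
apply: Lnorm_ae_eq => //.
- by apply: measurable_funB => //; exact: measurable_Lp.
- exact: measurable_funB.
- by apply: filterS (Lp_classE p1 mf_oo lf_oo) => x /(_ I) -> _.
Qed.

End fast_cauchy.

Lemma Lp_cauchy_cvg (F : set_system LpT) : ProperFilter F -> cauchy F -> cvg F.
Proof.
move=> FF /cauchyP Fc.
have e0 n : 0 < (4^-1 * 2^-1 ^+ n : R) by rewrite mulr_gt0// ?invr_gt0// exprn_gt0.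
have [u hu] : exists u : nat -> LpT, forall n, F (ball (u n) (4^-1 * 2^-1 ^+ n)).
  have /choice[u hu] := fun n => Fc _ (e0 n).
  by exists u.
have [n|G hG] := fast_cauchy_cvg (u := u).
  have [y [/= y1 y2]] := filter_ex (filterI (hu n) (hu n.+1)).
  move: y1 y2; rewrite -!ball_normE/= => y1 y2.
  have := ler_distD y (u n.+1) (u n); rewrite (distrC y).
  have : 0 < (2^-1 : R) ^+ n by rewrite exprn_gt0.
  move: y1 y2; rewrite exprS.
  lra.
apply/cvg_ex; exists G; apply/cvg_ballP => e e_gt0.
have [n hn] : exists n, 3 * (2^-1 : R) ^+ n < e.
  have /cvgrPdist_lt/(_ e e_gt0) : (3 * (2^-1 : R) ^+ n) @[n --> \oo] --> (0 : R).
    by apply: cvg_geometric; rewrite ger0_norm// invf_lt1// ltr1n.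
  move=> [n _ /(_ n (leqnn _))/=]; rewrite sub0r normrN => h.
  by exists n; rewrite (le_lt_trans (ler_norm _)).
apply: filterS (hu n) => y; rewrite -!ball_normE/= => uy.
have := ler_distD (u n) G y; have := hG n.
have : 0 < (2^-1 : R) ^+ n by rewrite exprn_gt0.
move: uy hn; lra.
Qed.

End Lp_complete.

HB.instance Definition _ d (T : measurableType d) (R : realType)
  (mu : {measure set T -> \bar R}) (p : R) (p1 : 1 <= p) :=
  Uniform_isComplete.Build (Lp mu p1) (@Lp_cauchy_cvg d T R mu p p1).

(* The category of (real) Banach spaces and linear isometries. The objects are
   the [completeNormedModType]s; an isometry need not be surjective. *)
Record isometry (R : realType) (V W : normedModType R) := Isometry {
  isometry_fun :> V -> W ;
  isometry_linear : linear isometry_fun ;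
  isometry_norm : forall x, `|isometry_fun x| = `|x| }.

Lemma isometry_ext (R : realType) (V W : normedModType R) (f g : isometry V W) :
  f =1 g -> f = g.
Proof.
case: f g => [f lf nf] [g lg ng]/= /funext fg; rewrite fg in lf nf *.
by congr Isometry; exact: Prop_irrelevance.
Qed.

Record directedSet := DirectedSet {
  ds_sort :> Type ;
  ds_le : ds_sort -> ds_sort -> Prop ;
  ds_inhabited : inhabited ds_sort ;
  ds_refl : forall i, ds_le i i ;
  ds_trans : forall i j k, ds_le i j -> ds_le j k -> ds_le i k ;
  ds_ub : forall i j, exists k, ds_le i k /\ ds_le j k }.

Record ban_diagram (R : realType) (I : directedSet) := BanDiagram {
  diag_obj :> I -> completeNormedModType R ;
  diag_map : forall i j, ds_le i j -> isometry (diag_obj i) (diag_obj j) ;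
  diag_map_id : forall i (ii : ds_le i i) x, diag_map ii x = x ;
  diag_map_comp : forall i j k (ij : ds_le i j) (jk : ds_le j k)
    (ik : ds_le i k) x, diag_map ik x = diag_map jk (diag_map ij x) }.

Record ban_cocone (R : realType) (I : directedSet) (X : ban_diagram R I) :=
  BanCocone {
  cocone_obj : completeNormedModType R ;
  cocone_map : forall i, isometry (X i) cocone_obj ;
  cocone_comm : forall i j (ij : ds_le i j) x,
    cocone_map i x = cocone_map j (diag_map X ij x) }.

Definition is_colimit (R : realType) (I : directedSet) (X : ban_diagram R I)
    (L : ban_cocone X) : Prop :=
  forall C : ban_cocone X,
    exists! u : isometry (cocone_obj L) (cocone_obj C),
      forall i x, u (cocone_map L i x) = cocone_map C i x.

Section pullback.
Context {d1 d2} {X : measurableType d1} {Y : measurableType d2} {R : realType}.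
Local Notation "''N[' mu ]_ p [ F ]" := (Lnorm mu p F).

Record measure_preserving (mu : {measure set X -> \bar R})
    (nu : {measure set Y -> \bar R}) (h : X -> Y) : Prop := MeasurePreserving {
  mp_measurable : measurable_fun setT h ;
  mp_preimage : forall A, measurable A -> mu (h @^-1` A) = nu A }.

Variables (mu : {measure set X -> \bar R}) (nu : {measure set Y -> \bar R}).
Variables (h : X -> Y) (hmp : measure_preserving mu nu h).
Variables (p : R) (p1 : 1 <= p).

Lemma Lnorm_comp (f : Y -> R) : measurable_fun setT f ->
  'N[mu]_p%:E[EFin \o (f \o h)] = 'N[nu]_p%:E[EFin \o f].
Proof.
move=> mf; rewrite !LnormE; congr poweR.
have mh := mp_measurable hmp.
pose hm := isMeasurableFun.Build _ _ _ _ _ mh.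
pose hp : {mfun _ >-> _} := HB.pack h hm.
rewrite (eq_measure_integral (pushforward mu hp)); last first.
  by move=> A mA _; rewrite /pushforward -(mp_preimage hmp mA).
have m0 := measurable_powR_norm p mf.
rewrite (@ge0_integral_pushforward _ _ _ _ _ _ mh mu setT _ measurableT m0)//.
Qed.

Lemma measurable_pullback (F : Lp nu p1) : measurable_fun setT (F \o h).
Proof.
by apply: measurableT_comp; [exact: measurable_Lp|exact: mp_measurable hmp].
Qed.

Lemma finite_norm_pullback (F : Lp nu p1) : finite_norm mu p%:E (F \o h).
Proof.
rewrite /finite_norm Lnorm_comp; first exact: finite_norm_Lp.
exact: measurable_Lp.
Qed.

(* The class of [F \o h]; it does not depend on the representative of [F], see
   [ae_pullback]. *)
Definition pullback_fun (F : Lp nu p1) : Lp mu p1 :=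
  Lp_class p1 (measurable_pullback F) (finite_norm_pullback F).

Lemma ae_pullback (f g : Y -> R) :
  f = g %[ae nu] -> f \o h = g \o h %[ae mu].
Proof.
move=> [N [mN N0 sub]]; exists (h @^-1` N); split.
- by rewrite -[X in measurable X]setTI; exact: mp_measurable hmp _ _ _.
- by rewrite (mp_preimage hmp).
- by move=> x /= hx; apply: sub => /= e; exact: hx.
Qed.

Lemma pullback_funE (F : Lp nu p1) : (pullback_fun F : X -> R) = F \o h %[ae mu].
Proof. exact: Lp_classE. Qed.

Lemma pullback_linear : linear pullback_fun.
Proof.
move=> a F G; apply: ae_eq_Lp.
apply: (filter_app _ _ (pullback_funE (a *: F + G))).
apply: (filter_app _ _ (ae_pullback (Lp_addE (a *: F) G))).
apply: (filter_app _ _ (ae_pullback (Lp_scaleE a F))).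
apply: (filter_app _ _ (Lp_addE (a *: pullback_fun F) (pullback_fun G))).
apply: (filter_app _ _ (Lp_scaleE a (pullback_fun F))).
apply: (filter_app _ _ (pullback_funE F)).
apply: (filter_app _ _ (pullback_funE G)).
apply: filterE => x /(_ I) /= e1 /(_ I) /= e2 /(_ I) /= e3 /(_ I) /= e4.
move=> /(_ I) /= e5 /(_ I) /= e6 /(_ I) /= e7 _.
rewrite e7 [LHS]e6 e5.
by rewrite [RHS]e4 e3 e2 e1.
Qed.

Lemma pullback_norm (F : Lp nu p1) : `|pullback_fun F| = `|F|.
Proof.
apply: EFin_inj; rewrite !Lp_normrE Lnorm_class Lnorm_comp//.
exact: measurable_Lp.
Qed.

Definition pullback : isometry (Lp nu p1) (Lp mu p1) :=
  Isometry pullback_linear pullback_norm.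

End pullback.

Lemma pullback_id d (X : measurableType d) (R : realType)
    (mu : {measure set X -> \bar R}) (h : X -> X)
    (hmp : measure_preserving mu mu h) (p : R) (p1 : 1 <= p) (F : Lp mu p1) :
  (forall x, h x = x) -> pullback hmp p1 F = F.
Proof.
move=> hE; apply: ae_eq_Lp; apply: filterS (pullback_funE hmp F) => x /(_ I) + _.
by rewrite /= hE.
Qed.

Lemma pullback_comp d1 d2 d3 (X : measurableType d1) (Y : measurableType d2)
    (Z : measurableType d3) (R : realType) (mu : {measure set X -> \bar R})
    (nu : {measure set Y -> \bar R}) (la : {measure set Z -> \bar R})
    (h : X -> Y) (k : Y -> Z) (l : X -> Z) (hh : measure_preserving mu nu h)
    (hk : measure_preserving nu la k) (hl : measure_preserving mu la l)
    (p : R) (p1 : 1 <= p) (F : Lp la p1) :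
  (forall x, l x = k (h x)) ->
  pullback hl p1 F = pullback hh p1 (pullback hk p1 F).
Proof.
move=> lE; apply: ae_eq_Lp.
apply: (filter_app _ _ (pullback_funE hl F)).
apply: (filter_app _ _ (pullback_funE hh (pullback hk p1 F))).
apply: (filter_app _ _ (ae_pullback hh (pullback_funE hk F))).
apply: filterE => x /(_ I) /= e1 /(_ I) /= e2 /(_ I) /= e3 _.
by rewrite [LHS]e3 lE [RHS]e2 e1.
Qed.

Notation borel X := (g_sigma_algebraType (@open X)).

Section smooth.
Context {R : realType} {n : nat}.

(* Meant for open U: f has continuous partial derivatives up to order k on U. *)
Fixpoint Ck (k : nat) (U : set 'rV[R]_n) (f : 'rV[R]_n -> R) : Prop :=
  match k with
  | 0 => forall u, U u -> {for u, continuous f}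
  | k'.+1 => (forall u, U u -> differentiable f u) /\
      forall j : 'I_n, Ck k' U (fun u => 'D_(delta_mx 0 j) f u)
  end.

Definition smooth_on (U : set 'rV[R]_n) (f : 'rV[R]_n -> R) : Prop :=
  forall k, Ck k U f.

End smooth.

(* A smooth atlas of charts with values in R^n, with a Riemannian metric given by
   its Gram matrices in the charts. [chart_inv i] is only meaningful on the image
   of [chart i]. Row vectors: the differential of a map is [v |-> v *m J], whence
   the form of [metric_transition]. *)
Record riemannian_structure (R : realType) (M : topologicalType) (n : nat) :=
  RiemannianStructure {
  chart_index : Type ;
  chart_dom : chart_index -> set M ;
  chart : chart_index -> M -> 'rV[R]_n ;
  chart_inv : chart_index -> 'rV[R]_n -> M ;
  chart_at : M -> chart_index ;
  chart_at_dom : forall x, chart_dom (chart_at x) x ;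
  chart_dom_open : forall i, open (chart_dom i) ;
  chart_image_open : forall i, open (chart i @` chart_dom i) ;
  chartK : forall i x, chart_dom i x -> chart_inv i (chart i x) = x ;
  chart_continuous : forall i x, chart_dom i x -> {for x, continuous (chart i)} ;
  chart_inv_continuous : forall i u, (chart i @` chart_dom i) u ->
    {for u, continuous (chart_inv i)} ;
  transition_smooth : forall i j k,
    smooth_on (chart i @` (chart_dom i `&` chart_dom j))
      (fun u => chart j (chart_inv i u) 0 k) ;
  metric : chart_index -> 'rV[R]_n -> 'M[R]_n ;
  metric_smooth : forall i k l,
    smooth_on (chart i @` chart_dom i) (fun u => metric i u k l) ;
  metric_sym : forall i u, (chart i @` chart_dom i) u ->
    (metric i u)^T = metric i u ;
  metric_pos : forall i u (v : 'rV[R]_n), (chart i @` chart_dom i) u -> v != 0 ->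
    0 < (v *m metric i u *m v^T) 0 0 ;
  metric_transition : forall i j x, chart_dom i x -> chart_dom j x ->
    let J := jacobian (chart j \o chart_inv i) (chart i x) in
    metric i (chart i x) = J *m metric j (chart j x) *m J^T }.

Record closed_riemannian_manifold (R : realType) (M : topologicalType) (n : nat) :=
  ClosedRiemannianManifold {
  riemannian :> riemannian_structure R M n ;
  manifold_hausdorff : hausdorff_space M ;
  manifold_compact : compact [set: M] ;
  manifold_connected : connected [set: M] }.

Section laplace_beltrami.
Context {R : realType} {M : topologicalType} {n : nat}.
Variable g : riemannian_structure R M n.
Implicit Types i : chart_index g.

Definition volume_density i (u : 'rV[R]_n) : R := Num.sqrt (\det (metric i u)).

(* |g|^(-1/2) \sum_(j, k) d_j (|g|^(1/2) g^(jk) d_k f) *)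
Definition chart_laplacian i (f : 'rV[R]_n -> R) (u : 'rV[R]_n) : R :=
  (volume_density i u)^-1 *
  \sum_(j < n) 'D_(delta_mx 0 j) (fun v => volume_density i v *
     \sum_(k < n) invmx (metric i v) j k * 'D_(delta_mx 0 k) f v) u.

(* Does not depend on the chart around x. *)
Definition laplacian (f : M -> R) (x : M) : R :=
  let i := chart_at g x in chart_laplacian i (f \o chart_inv i) (chart i x).

Definition smooth (f : M -> R) : Prop :=
  forall i, smooth_on (chart i @` chart_dom i) (f \o chart_inv i).

End laplace_beltrami.

(* Lebesgue integral over R^n, of a nonnegative Borel function, as an iterated
   integral. *)
Fixpoint rV_integral (R : realType) (n : nat) : ('rV[R]_n -> \bar R) -> \bar R :=
  match n return ('rV[R]_n -> \bar R) -> \bar R with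
  | 0 => fun f => f 0
  | n'.+1 => fun f => (\int[lebesgue_measure]_x
      rV_integral (fun v : 'rV[R]_n' => f (row_mx (x%:M : 'rV[R]_1) v)))%E
  end.

(* In each chart the volume has density |g|^(1/2); as the chart domains cover M,
   this determines mu. *)
Definition is_riemannian_volume (R : realType) (M : ptopologicalType) (n : nat)
    (g : riemannian_structure R M n) (mu : {measure set (borel M) -> \bar R}) : Prop :=
  forall (i : chart_index g) (B : set (borel M)), measurable B -> B `<=` chart_dom i ->
    mu B = rV_integral (fun u => (volume_density i u * \1_(chart i @` B) u)%:E).

Record c0_semigroup (R : realType) (V : normedModType R) (E : R -> V -> V) : Prop :=
  C0Semigroup {
  semigroup_linear : forall t, 0 <= t -> linear (E t) ;
  semigroup_bounded : forall t, 0 <= t -> continuous (E t) ;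
  semigroup0 : forall x, E 0 x = x ;
  semigroupD : forall s t, 0 <= s -> 0 <= t -> forall x, E (s + t) x = E s (E t x) ;
  semigroup_cvg0 : forall x, E t x @[t --> 0^'+] --> x }.

Definition generator (R : realType) (V : normedModType R) (E : R -> V -> V) :
    set (V * V) :=
  [set z | h^-1 *: (E h z.1 - z.1) @[h --> 0^'+] --> z.2].

Lemma le12 (R : realType) : 1 <= 2 :> R. Proof. exact: ler1n. Qed.

Section heat_kernel.
Context {R : realType} {M : ptopologicalType} {n : nat}.
Variable g : riemannian_structure R M n.
Variable mu : {measure set (borel M) -> \bar R}.

Notation L2 := (Lp mu (le12 R)).

Definition laplacian_graph : set (L2 * L2) :=
  [set z : L2 * L2 | exists2 f : M -> R, smooth g f &
     (z.1 : borel M -> R) = f %[ae mu] /\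
     (z.2 : borel M -> R) = laplacian g f %[ae mu]].

(* E t = e^(t Delta): Delta, with domain the smooth functions, is essentially
   self-adjoint on L2, and E is the semigroup generated by its closure. *)
Definition is_heat_semigroup (E : R -> L2 -> L2) : Prop :=
  c0_semigroup E /\ generator E = closure laplacian_graph.

(* Continuity fixes the values of the kernel, which are otherwise determined only
   almost everywhere. *)
Definition is_heat_kernel (q : R -> M -> M -> R) : Prop :=
  exists2 E, is_heat_semigroup E &
    forall t, 0 < t -> continuous (fun z : M * M => q t z.1 z.2) /\
      forall F : L2, (E t F : borel M -> R) =
        (fun x => \int[mu]_y (q t x y * F y)) %[ae mu].

End heat_kernel.

Notation unit_itv R := (set_type (`[0%R, 1%R]%classic : set R)).

Lemma unit_itv0_subproof (R : realType) : (0 : R) \in (`[0%R, 1%R]%classic : set R).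
Proof. by rewrite inE/= in_itv/= lexx ler01. Qed.

Definition unit_itv0 (R : realType) : unit_itv R := exist _ 0 (unit_itv0_subproof R).

Record path_space (R : realType) (M : topologicalType) (x0 : M) := PathSpace {
  path_fun :> unit_itv R -> M ;
  path_continuous : continuous path_fun ;
  path_start : path_fun (unit_itv0 R) = x0 }.

Definition cst_path (R : realType) (M : topologicalType) (x0 : M) :
  path_space R x0 := @PathSpace R M x0 (cst x0) (@cst_continuous _ _ x0) erefl.

Section path_space_topology.
Context (R : realType) (M : uniformType) (x0 : M).

(* The uniform topology. A compact Hausdorff space has a single compatible
   uniformity, so for a closed manifold M it does not depend on the choice of a
   metric inducing the topology of M. *)
HB.instance Definition _ := gen_eqMixin (path_space R x0).
HB.instance Definition _ := gen_choiceMixin (path_space R x0).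
HB.instance Definition _ := isPointed.Build (path_space R x0) (cst_path R x0).
HB.instance Definition _ := Topological.copy (path_space R x0)
  (@initial_topology (path_space R x0) {uniform unit_itv R -> M} (@path_fun R M x0)).

Lemma path_eval_continuous (s : unit_itv R) :
  continuous (fun g : path_space R x0 => g s).
Proof.
move=> g.
apply: (@continuous_comp _ {uniform unit_itv R -> M} _ (@path_fun R M x0) (fun f => f s)).
  exact: initial_continuous.
have sT : [set s] `<=` [set: unit_itv R] by [].
have := @uniform_subset_cvg _ _ (path_fun g) [set: unit_itv R] [set s]
  (nbhs (path_fun g : {uniform unit_itv R -> M})) _ sT.
by rewrite uniform_set1; apply.
Qed.
End path_space_topology.

Lemma measurable_path_eval (R : realType) (M : puniformType) (x0 : M)
    (s : unit_itv R) :
  measurable_fun setT (fun g : borel (path_space R x0) => g s : borel M).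
Proof.
apply: (@measurability _ _ (borel (path_space R x0)) (borel M) setT
  (fun g => g s) (@open M)) => //.
move=> _ [A oA <-]; rewrite setTI; apply: sub_sigma_algebra.
have /continuousP := @path_eval_continuous R M x0 s.
exact.
Qed.

(* The partition 0 = t_0 < t_1 < ... < t_n <= 1, n >= 1, is represented by the
   sequence t_1, ..., t_n: the point 0 is implicit, as it indexes no factor of
   the product M^T, which is the space of (size T)-tuples over M. *)
Record time_partition (R : realType) := TimePartition {
  times :> seq (unit_itv R) ;
  times_sorted : path <%R (0 : R) (map set_val times) ;
  times_nonempty : (0 < size times)%N }.

Section time_partition.
Context {R : realType}.
Implicit Types T : time_partition R.

Definition partition_le T T' : Prop := {subset times T <= times T'}.

Lemma partition_refl T : partition_le T T. Proof. by []. Qed.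

Lemma partition_trans T T' T'' :
  partition_le T T' -> partition_le T' T'' -> partition_le T T''.
Proof. by move=> h h' x /h /h'. Qed.

Lemma times_gt0 T t : t \in times T -> 0 < set_val t :> R.
Proof.
move=> tT; have := times_sorted T.
rewrite (path_sortedE lt_trans) => /andP[/allP + _].
by apply; exact: map_f.
Qed.

Lemma uniq_times T : uniq (times T).
Proof.
have := path_sorted (times_sorted T).
rewrite lt_sorted_uniq_le => /andP[+ _].
exact: map_uniq.
Qed.

Lemma partition_ub T T' :
  exists T'', partition_le T T'' /\ partition_le T' T''.
Proof.
pose r (s t : unit_itv R) := (set_val s : R) <= set_val t.
pose l := sort r (undup (times T ++ times T')).
have ml t : (t \in l) = (t \in times T) || (t \in times T').
  by rewrite mem_sort mem_undup mem_cat.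
have l0 : (0 < size l)%N.
  rewrite size_sort; have := times_nonempty T.
  case E : (times T) => [//|t s] _.
  have : t \in undup ((t :: s) ++ times T') by rewrite mem_undup mem_cat in_cons eqxx.
  by case: (undup _).
have sl : path <%R (0 : R) (map set_val l).
  rewrite (path_sortedE lt_trans); apply/andP; split.
    apply/allP => _ /mapP[t + ->]; rewrite ml => /orP[]; exact: times_gt0.
  rewrite lt_sorted_uniq_le map_inj_uniq; last exact: val_inj.
  rewrite sort_uniq undup_uniq/= sorted_map.
  by apply: sort_sorted => s t; exact: le_total.
exists (TimePartition sl l0); split=> t tT; rewrite /= ml tT ?orbT//.
Qed.

Lemma unit_itv1_subproof : (1 : R) \in (`[0%R, 1%R]%classic : set R).
Proof. by rewrite inE/= in_itv/= lexx ler01. Qed.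

Lemma partition1_subproof :
  path <%R (0 : R) (map set_val [:: (exist _ 1 unit_itv1_subproof : unit_itv R)]).
Proof. by rewrite /= set_valE/= ltr01. Qed.

Lemma partition_inhabited : inhabited (time_partition R).
Proof. exact: (inhabits (@TimePartition R [:: _] partition1_subproof isT)). Qed.

Definition partitions : directedSet :=
  DirectedSet partition_inhabited partition_refl partition_trans partition_ub.

End time_partition.
Arguments partitions : clear implicits.

Section wiener.
Context {R : realType} {M : puniformType}.
Variables (mu : {measure set (borel M) -> \bar R}) (q : R -> M -> M -> R).
Variable x0 : M.
Implicit Types T : time_partition R.

Notation mprod T := ((size (times T)).-tuple (borel M)).

(* \int_(B_1) ... \int_(B_n) f(x_1, ..., x_n) dmu(x_n) ... dmu(x_1) *)
Fixpoint iter_integral n :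
    ('I_n -> set (borel M)) -> (n.-tuple (borel M) -> R) -> \bar R :=
  match n return
      ('I_n -> set (borel M)) -> (n.-tuple (borel M) -> R) -> \bar R with
  | 0 => fun _ f => (f [tuple])%:E
  | n'.+1 => fun B f => (\int[mu]_(x in B ord0)
      iter_integral (fun i => B (lift ord0 i)) (fun v => f [tuple of x :: v]))%E
  end.

(* \prod_i q (t_i - t_(i-1)) x_i x_(i-1), where t_0 = 0 and the 0-th point is x0 *)
Definition path_density T (x : mprod T) : R :=
  let t := 0 :: map set_val (times T) in
  let y := x0 :: x in
  \prod_(i < size (times T)) q (t`_i.+1 - t`_i) (nth x0 y i.+1) (nth x0 y i).

(* P is the measure with density [path_density] w.r.t. the product of copies of
   mu; [f \_ A] is f on A and 0 outside A. *)
Definition is_fdd T (P : probability (mprod T) R) : Prop :=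
  forall A, measurable A -> P A = iter_integral (fun=> setT) (path_density (T:=T) \_ A).

Definition eval_times T (g : borel (path_space R x0)) : mprod T :=
  [tuple g (tnth (in_tuple (times T)) i) | i < size (times T)].

Definition is_wiener (W : probability (borel (path_space R x0)) R) : Prop :=
  forall T (B : 'I_(size (times T)) -> set (borel M)),
    (forall i, measurable (B i)) ->
    W [set g | forall i, B i (g (tnth (in_tuple (times T)) i))] =
    iter_integral B (path_density (T:=T)).

(* The default value [x0] of [nth] is irrelevant when T is included in T'. *)
Definition restrict_times T T' (x : mprod T') : mprod T :=
  [tuple nth x0 x (index (tnth (in_tuple (times T)) i) (times T'))
    | i < size (times T)].

Lemma iter_integral0 n (B : 'I_n -> set (borel M)) :
  iter_integral B (fun=> 0) = 0%E.
Proof.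
elim: n B => [//|n ih] B /=.
by under eq_integral do rewrite ih; rewrite integral0.
Qed.

Definition box n (B : 'I_n -> set (borel M)) : set (n.-tuple (borel M)) :=
  [set x | forall i, B i (tnth x i)].

Lemma iter_integral_box n (B : 'I_n -> set (borel M)) f :
  iter_integral B f = iter_integral (fun=> setT) (f \_ (box B)).
Proof.
elim: n B f => [|n ih] B f /=.
  by rewrite patchE mem_set// => -[].
rewrite integral_mkcond; apply: eq_integral => x _.
rewrite patchE; case: ifPn => [/set_mem Bx|/negP Bx].
  rewrite ih; congr iter_integral; apply/funext => v; rewrite !patchE.
  rewrite (_ : (v \in _) = ([tuple of x :: v] \in box B))//.
  apply/idP/idP => /set_mem Bv; apply/mem_set => i.
    case: (unliftP ord0 i) => [j|] ->; last by rewrite tnth0.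
    by rewrite tnthS; exact: Bv.
  by have := Bv (lift ord0 i); rewrite tnthS.
rewrite (_ : (fun v => _) = (fun=> 0)) ?iter_integral0//.
apply/funext => v; rewrite patchE memNset// => /(_ ord0).
by rewrite tnth0 => Bx0; apply: Bx; exact/mem_set.
Qed.

Lemma box_setI_closed n :
  setI_closed [set box B | B in [set B : 'I_n -> set (borel M) | forall i, measurable (B i)]].
Proof.
move=> _ _ [B mB <-] [C mC <-]; exists (fun i => B i `&` C i).
  by move=> i; exact: measurableI.
apply/seteqP; split=> x /=.
  by move=> h; split=> i; have [] := h i.
by move=> [h h'] i; split.
Qed.

Lemma box_measurable n (B : 'I_n -> set (borel M)) :
  (forall i, measurable (B i)) -> measurable (box B).
Proof.
move=> mB; rewrite (_ : box B = \big[setI/setT]_(i < n) ((fun x => tnth x i) @^-1` B i)).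
  apply: bigsetI_measurable => i _; rewrite -[X in measurable X]setTI.
  exact: measurable_tnth.
rewrite -bigcap_seq; apply/seteqP; split=> x /= h.
  by move=> i _; exact: h.
by move=> i; apply: h; rewrite /= mem_index_enum.
Qed.

Lemma measurable_tuple_box n :
  (measurable : set (set (n.-tuple (borel M)))) =
  <<s [set box B | B in [set B : 'I_n -> set (borel M) | forall i, measurable (B i)]] >>.
Proof.
apply/seteqP; split.
  apply: smallest_sub; first exact: smallest_sigma_algebra.
  rewrite -bigcup_seq; apply: bigcup_sub => i _ _ [A mA <-]; rewrite setTI.
  apply: sub_sigma_algebra; exists (fun j => if j == i then A else setT).
    by move=> j; case: ifP.
  apply/seteqP; split=> x /=; first by move=> /(_ i); rewrite eqxx.
  by move=> Ax j; case: eqP => // ->.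
apply: smallest_sub; first exact: sigma_algebra_measurable.
by move=> _ [B mB <-]; exact: box_measurable.
Qed.

Lemma measurable_eval_times T : measurable_fun setT (@eval_times T).
Proof.
apply/measurable_fun_tnthP => i.
apply: eq_measurable_fun (measurable_path_eval (tnth (in_tuple (times T)) i)).
by move=> g _; rewrite /= tnth_mktuple.
Qed.

Lemma measurable_restrict_times T T' : partition_le T T' ->
  measurable_fun setT (@restrict_times T T').
Proof.
move=> TT'; apply/measurable_fun_tnthP => i.
have h : (index (tnth (in_tuple (times T)) i) (times T') < size (times T'))%N.
  by rewrite index_mem; apply: TT'; exact: (mem_tnth i (in_tuple _)).
apply: eq_measurable_fun (measurable_tnth (Ordinal h)).
by move=> x _; rewrite /= tnth_mktuple (tnth_nth x0).
Qed.

Lemma restrict_eval_times T T' (g : borel (path_space R x0)) :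
  partition_le T T' -> restrict_times T (eval_times T' g) = eval_times T g.
Proof.
move=> TT'; apply: eq_from_tnth => i; rewrite !tnth_mktuple.
have h : (index (tnth (in_tuple (times T)) i) (times T') < size (times T'))%N.
  by rewrite index_mem; apply: TT'; exact: (mem_tnth i (in_tuple _)).
rewrite -(tnth_nth x0 _ (Ordinal h)) tnth_mktuple; congr (g _).
rewrite (tnth_nth (tnth (in_tuple (times T)) i))/= nth_index//.
by rewrite -index_mem.
Qed.

Section setting.
Variable W : probability (borel (path_space R x0)) R.
Hypothesis hW : is_wiener W.
Variable P : forall T, probability (mprod T) R.
Hypothesis hP : forall T, is_fdd (P T).

(* The consistency of the measures P T (Chapman-Kolmogorov) is obtained from the
   Wiener measure W, of which they are the finite-dimensional distributions. *)
Lemma eval_times_preserving T : measure_preserving W (P T) (@eval_times T).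
Proof.
split; first exact: measurable_eval_times.
move=> A mA.
rewrite -[LHS]/(pushforward W (@eval_times T) A).
pose hm := isMeasurableFun.Build _ _ _ _ _ (@measurable_eval_times T).
pose h : {mfun _ >-> _} := HB.pack (@eval_times T) hm.
apply: (@measure_unique _ _ _ _ (fun=> setT) (measurable_tuple_box _) (@box_setI_closed _)
   _ _ (pushforward W h) (P T)) => //.
- by move=> _; exists (fun=> setT) => //; apply/seteqP; split.
- by apply/seteqP; split => // x _; exists 0%N.
- move=> _ [B mB <-]; apply: etrans (esym (hP (box_measurable mB))).
  rewrite -iter_integral_box -hW//; congr (W _).
  apply/seteqP; split=> g /= hg i.
    by have := hg i; rewrite tnth_mktuple.
  by rewrite tnth_mktuple.
- move=> _; rewrite /pushforward (le_lt_trans (probability_le1 _ _)) ?ltry//.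
  by rewrite -[X in measurable X]setTI; exact: (@measurable_eval_times T).
Qed.

Lemma restrict_times_preserving T T' (TT' : partition_le T T') :
  measure_preserving (P T') (P T) (@restrict_times T T').
Proof.
split; first exact: measurable_restrict_times.
move=> A mA.
have mB : measurable (@restrict_times T T' @^-1` A).
  by rewrite -[X in measurable X]setTI; exact: measurable_restrict_times.
rewrite -(mp_preimage (eval_times_preserving T') mB).
rewrite -(mp_preimage (eval_times_preserving T) mA); congr (W _).
by apply/seteqP; split => g /=; rewrite restrict_eval_times.
Qed.

Variables (p : R) (p1 : 1 <= p).

Definition restrict_star T T' (TT' : partition_le T T') :
    isometry (Lp (P T) p1) (Lp (P T') p1) :=
  pullback (restrict_times_preserving TT') p1.

Definition eval_star T : isometry (Lp (P T) p1) (Lp W p1) :=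
  pullback (eval_times_preserving T) p1.

Lemma restrict_times_id T (x : mprod T) : restrict_times T x = x.
Proof.
apply: eq_from_tnth => i; rewrite tnth_mktuple (tnth_nth x0).
by rewrite index_uniq ?uniq_times.
Qed.

Lemma restrict_times_comp T T' T'' (x : mprod T'') :
  partition_le T T' -> partition_le T' T'' ->
  restrict_times T (restrict_times T' x) = restrict_times T x.
Proof.
move=> TT' TT''; apply: eq_from_tnth => i; rewrite !tnth_mktuple.
have h : (index (tnth (in_tuple (times T)) i) (times T') < size (times T'))%N.
  by rewrite index_mem; apply: TT'; exact: (mem_tnth i (in_tuple _)).
rewrite -(tnth_nth x0 _ (Ordinal h)) tnth_mktuple; congr (nth _ _ (index _ _)).
rewrite (tnth_nth (tnth (in_tuple (times T)) i))/= nth_index//.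
by rewrite -index_mem.
Qed.

Definition Lp_diagram : ban_diagram R (partitions R) :=
  @BanDiagram R (partitions R) (fun T => Lp (P T) p1) restrict_star
    (fun T TT F => pullback_id _ _ (@restrict_times_id T))
    (fun T T' T'' TT' TT'' h F => pullback_comp _ _ _ _
       (fun x => esym (restrict_times_comp x TT' TT''))).

Definition wiener_cocone : ban_cocone Lp_diagram :=
  @BanCocone R (partitions R) Lp_diagram (Lp W p1) eval_star
    (fun T T' TT' F => pullback_comp _ _ _ _
       (fun g => esym (restrict_eval_times g TT'))).

End setting.
End wiener.

(* Main.v *)
From HB Require Import structures.
Require Import Defs.
From mathcomp Require Import all_boot all_order all_algebra.
From mathcomp Require Import all_classical all_reals all_analysis.
From mathcomp Require Import measurable_realfun lra.

Set Implicit Arguments.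
Unset Strict Implicit.
Unset Printing Implicit Defensive.

Import Order.TTheory GRing.Theory Num.Theory.
Import numFieldNormedType.Exports HBNNSimple.

Local Open Scope classical_set_scope.
Local Open Scope ring_scope.

(** The cocone is the colimit as soon as the union of the images of its maps is
    dense ([colimit_of_dense_cocone]): a colimit of Banach spaces along isometries
    is the completion of their directed union. Given another cocone over the same
    diagram, the map that it forces on that union is well defined, linear and
    isometric because any two indices have a common upper bound, and it extends in
    a unique way to the closure because the target is complete.

    It remains to see that functionals depending on finitely many times are dense
    in L^p of the Wiener measure. The closure of these functionals is a closed
    subspace which contains the indicators of the cylinders, i.e. of the events
    that concern finitely many times. By the pi-lambda theorem and dominated
    convergence, a closed subspace of L^p of a finite measure which contains the
    indicators of a pi-system generating the sigma-algebra contains all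
    indicators, then all nonnegative functions as monotone limits of simple
    functions, then everything ([closed_subspace_pi_system_full]).

    Finally the cylinders generate the Borel sigma-algebra of the uniform topology
    ([borel_path_space_cylinders]). This is where the compactness of M enters: like
    [0,1], M then has a countable basis, and an open set of paths is a countable
    union of events of the form: for finitely many pairs (J, B) of basic open sets
    of [0,1] and M, the path maps J into the closure of B. By continuity of the
    paths it is enough to test such a condition at countably many times. *)

(** * Colimits of Banach spaces along isometries *)

Section isometry_theory.
Context {R : realType} {V W : normedModType R}.
Variable u : Defs.isometry V W.

Lemma isometryB x y : u (x - y) = u x - u y.
Proof. by rewrite addrC -scaleN1r isometry_linear scaleN1r addrC. Qed.

Lemma isometry0 : u 0 = 0.
Proof. by rewrite -{1}(subrr 0) isometryB subrr. Qed.

Lemma isometry_dist x y : `|u x - u y| = `|x - y|.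
Proof. by rewrite -isometryB isometry_norm. Qed.

End isometry_theory.

Lemma dist_dist_le (R : numDomainType) (V : normedZmodType R) (p q x y : V) :
  `| `|p - q| - `|x - y| | <= `|p - x| + `|q - y|.
Proof.
rewrite (le_trans (ler_dist_dist _ _))// opprB [y - x]addrC addrACA.
by rewrite [- q + y]addrC -[y - q]opprB ler_normB.
Qed.

(** The bound on the first distance is divided by |l| + 1 rather than |l|, so that
    no case distinction on l = 0 is needed. *)
Lemma dist_linear_lt (R : realFieldType) (V : normedModType R)
    (l e : R) (v w v' w' : V) :
  `|v - w| < e / 2 / (`|l| + 1) -> `|v' - w'| < e / 2 ->
  `|(l *: v + v') - (l *: w + w')| < e.
Proof.
have l0 : 0 < `|l| + 1 by rewrite ltr_wpDl.
move=> vw vw'; rewrite opprD addrACA -scalerBr.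
rewrite (le_lt_trans (ler_normD _ _))// normrZ (splitr e) ler_ltD//.
rewrite -(divfK (lt0r_neq0 l0) (e / 2)) mulrC.
by rewrite ler_pM// ?ltW// ltrDl.
Qed.

Lemma inv2X_lt (R : realType) (e : R) : 0 < e -> exists n, (2^-1 : R) ^+ n < e.
Proof.
move=> e0.
have /cvgrPdist_lt/(_ e e0)[n _ /(_ n (leqnn _))] :
    ((2^-1 : R) ^+ n) @[n --> \oo] --> (0 : R).
  by apply: cvg_expr; rewrite ger0_norm// invf_lt1// ltr1n.
rewrite /= sub0r normrN => h.
by exists n; rewrite (le_lt_trans (ler_norm _)).
Qed.

Section colimit_of_dense_cocone.
Context {R : realType} {I : directedSet} {X : ban_diagram R I}.

Definition approximable (L : ban_cocone X) (x : cocone_obj L) : Prop :=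
  forall e : R, 0 < e -> exists i a, `|cocone_map L i a - x| < e.
Arguments approximable : clear implicits.

Lemma approximable_linear (L : ban_cocone X) (l : R) (x y : cocone_obj L) :
  approximable L x -> approximable L y -> approximable L (l *: x + y).
Proof.
move=> Lx Ly e e0.
have l0 : 0 < `|l| + 1 by rewrite ltr_wpDl.
have d0 : 0 < e / 2 / (`|l| + 1) by rewrite !divr_gt0.
have [i [a ax]] := Lx _ d0.
have [j [b bY]] := Ly _ (divr_gt0 e0 (ltr0n R 2)).
have [k [ik jk]] := ds_ub i j.
exists k, (l *: diag_map X ik a + diag_map X jk b).
by rewrite isometry_linear -!cocone_comm; exact: dist_linear_lt.
Qed.

Lemma approximable_closed (L : ban_cocone X) (x : cocone_obj L) :
  (forall e, 0 < e -> exists2 y, approximable L y & `|y - x| < e) ->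
  approximable L x.
Proof.
move=> h e e0; have e20 := divr_gt0 e0 (ltr0n R 2).
have [y /(_ _ e20)[i [a ay]] yx] := h _ e20.
exists i, a; rewrite (splitr e) (le_lt_trans (ler_distD y _ _))//.
exact: ltrD.
Qed.

Variables (L C : ban_cocone X).

(** The closure of the graph of the map that sends the image of a in L to the image
    of a in C, for a in some X i. It is the graph of the morphism from L to C. *)
Definition joint_limit (x : cocone_obj L) (z : cocone_obj C) : Prop :=
  forall e : R, 0 < e -> exists i a,
    `|cocone_map L i a - x| < e /\ `|cocone_map C i a - z| < e.
Arguments joint_limit : clear implicits.

(** Approximating elements of X i and X j can be compared in X k for a common upper
    bound k of i and j, and both cocones preserve their distance there. Uniqueness
    of the limit and preservation of the norm are the cases where x = y, and where
    y and w are 0. *)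
Lemma joint_limit_dist x z y w :
  joint_limit x z -> joint_limit y w -> `|z - w| = `|x - y|.
Proof.
move=> xz yw; apply/eqP; rewrite -subr_eq0 -normr_le0; apply/ler_addgt0Pr => e e0.
have e40 := divr_gt0 e0 (ltr0n R 4).
have [i [a [ax az]]] := xz _ e40; have [j [b [bY bw]]] := yw _ e40.
have [k [ik jk]] := ds_ub i j.
pose s := `|diag_map X ik a - diag_map X jk b|.
have sL : `|s - `|x - y| | <= e / 4 + e / 4.
  rewrite /s -(isometry_dist (cocone_map L k)) -!cocone_comm.
  by rewrite (le_trans (dist_dist_le _ _ _ _))// lerD// ltW.
have sC : `|s - `|z - w| | <= e / 4 + e / 4.
  rewrite /s -(isometry_dist (cocone_map C k)) -!cocone_comm.
  by rewrite (le_trans (dist_dist_le _ _ _ _))// lerD// ltW.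
rewrite add0r (le_trans (ler_distD s _ _))// [X in X + _]distrC.
by rewrite (le_trans (lerD sC sL))// -mulrDr -!mulrDr; lra.
Qed.

Lemma joint_limit_eq x z w : joint_limit x z -> joint_limit x w -> z = w.
Proof.
move=> xz xw; apply/eqP; rewrite -subr_eq0 -normr_eq0.
by rewrite (joint_limit_dist xz xw) subrr normr0.
Qed.

Lemma joint_limit0 : joint_limit 0 0.
Proof.
move=> e e0; have [i] := ds_inhabited I.
by exists i, 0; rewrite !isometry0 !subrr !normr0.
Qed.

Lemma joint_limit_linear l x z y w :
  joint_limit x z -> joint_limit y w -> joint_limit (l *: x + y) (l *: z + w).
Proof.
move=> xz yw e e0.
have l0 : 0 < `|l| + 1 by rewrite ltr_wpDl.
have d0 : 0 < e / 2 / (`|l| + 1) by rewrite !divr_gt0.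
have [i [a [ax az]]] := xz _ d0.
have [j [b [bY bw]]] := yw _ (divr_gt0 e0 (ltr0n R 2)).
have [k [ik jk]] := ds_ub i j.
exists k, (l *: diag_map X ik a + diag_map X jk b).
by split; rewrite isometry_linear -!cocone_comm; exact: dist_linear_lt.
Qed.

(** Completeness of the target is used here: approximations of x in L form a Cauchy
    sequence, and the same elements of the diagram, seen in the other cocone, have
    the same mutual distances. *)
Lemma joint_limit_total x : approximable L x -> exists z, joint_limit x z.
Proof.
move=> Lx.
have /choice[s hs] : forall n, exists s : {i : I & X i},
    `|cocone_map L (projT1 s) (projT2 s) - x| < 2^-1 ^+ n.
  move=> n; have [|i [a ax]] := Lx (2^-1 ^+ n); first by rewrite exprn_gt0.
  by exists (existT _ i a).
pose v n := cocone_map L (projT1 (s n)) (projT2 (s n)).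
pose w n := cocone_map C (projT1 (s n)) (projT2 (s n)).
have vw m n : `|w m - w n| = `|v m - v n|.
  have [k [mk nk]] := ds_ub (projT1 (s m)) (projT1 (s n)).
  by rewrite /v /w !(cocone_comm _ mk) !(cocone_comm _ nk) !isometry_dist.
have near_x e : 0 < e -> exists N, forall n, (N <= n)%N -> `|v n - x| < e.
  move=> /inv2X_lt[N hN]; exists N => n Nn.
  rewrite (lt_trans (hs n))// (le_lt_trans _ hN)// ler_wiXn2l//.
  by rewrite invf_le1// ler1n.
have : cvgn w.
  apply/cauchy_cvgP/cauchyP => e e0.
  have [N hN] := near_x _ (divr_gt0 e0 (ltr0n R 2)).
  exists (w N), N => // n /= Nn; rewrite -ball_normE/= vw (splitr e).
  rewrite (le_lt_trans (ler_distD x _ _))// ltrD//; first exact: hN.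
  by rewrite distrC hN.
move=> /cvg_ex[z /cvgrPdist_lt wz]; exists z => e e0.
have [N hN] := near_x _ e0; have [N' _ hN'] := wz _ e0.
pose n := maxn N N'.
exists (projT1 (s n)), (projT2 (s n)); split; first by apply: hN; rewrite leq_maxl.
by rewrite distrC; apply: hN'; rewrite /= leq_maxr.
Qed.

End colimit_of_dense_cocone.
Arguments approximable {R I X} L x.
Arguments joint_limit {R I X} L C x z.

(** Uniqueness: the graph of a morphism that commutes with the cocones is contained
    in [joint_limit], which is already the graph of a function. *)
Theorem colimit_of_dense_cocone (R : realType) (I : directedSet)
    (X : ban_diagram R I) (L : ban_cocone X) :
  (forall x, approximable L x) -> is_colimit L.
Proof.
move=> Ldense C.
have /choice[u hu] : forall x, exists z, joint_limit L C x z.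
  by move=> x; exact: joint_limit_total.
have u_lin : linear u.
  by move=> l x y; apply: joint_limit_eq (hu _) (joint_limit_linear _ _ _).
have u_norm x : `|u x| = `|x|.
  by rewrite -[u x]subr0 (joint_limit_dist (hu x) (joint_limit0 _ _)) subr0.
exists (Isometry u_lin u_norm); split => [i a|w hw].
  apply: joint_limit_eq (hu _) _ => e e0.
  by exists i, a; rewrite !subrr !normr0.
apply: isometry_ext => x /=; apply: joint_limit_eq (hu x) _ => e e0.
have [i [a ax]] := Ldense x _ e0.
by exists i, a; rewrite -hw isometry_dist.
Qed.

(** * Closed subspaces of L^p generated by a pi-system *)

Section finite_norm_theory.
Context {d} {T : measurableType d} {R : realType}.
Variable mu : {measure set T -> \bar R}.
Variables (p : R) (p1 : 1 <= p).

Let pge0 : 0 <= p. Proof. by rewrite (le_trans ler01). Qed.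

Lemma finite_norm_integral (f : T -> R) : finite_norm mu p%:E f ->
  (\int[mu]_x (`|f x| `^ p)%:E < +oo)%E.
Proof.
rewrite /finite_norm => lf.
have N0 : (0 <= Lnorm mu p%:E (EFin \o f))%E by exact: Lnorm_ge0.
have Nf : Lnorm mu p%:E (EFin \o f) \is a fin_num by rewrite ge0_fin_numE.
have [+ _] := Lnorm_leP mu p1 f (fine_ge0 N0).
by rewrite fineK// => /(_ (lexx _))/le_lt_trans; apply; exact: ltry.
Qed.

Lemma finite_norm_le (f g : T -> R) :
  measurable_fun setT f -> measurable_fun setT g ->
  (forall x, `|f x| <= `|g x|) ->
  finite_norm mu p%:E g -> finite_norm mu p%:E f.
Proof.
move=> mf mg fg lg; rewrite /finite_norm LnormE poweR_lty//.
apply: le_lt_trans (finite_norm_integral lg).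
apply: ge0_le_integral => //; try exact: measurable_powR_norm.
by move=> x _; rewrite lee_fin ge0_ler_powR ?nnegrE.
Qed.

Lemma finite_norm_indic (A : set T) : (mu setT < +oo)%E -> measurable A ->
  finite_norm mu p%:E (\1_A : T -> R).
Proof.
move=> mufin mA; apply: (@finite_norm_le _ (cst 1)) => //.
  move=> x; rewrite normr1 indicE; by case: (x \in A); rewrite ?normr1 ?normr0.
rewrite /finite_norm LnormE poweR_lty//.
under eq_integral do rewrite normr1 powR1.
by rewrite integral_cst// mul1e.
Qed.

End finite_norm_theory.

Section Lp_density.
Context {d} {T : measurableType d} {R : realType}.
Variable mu : {measure set T -> \bar R}.
Hypothesis mu_finite : (mu setT < +oo)%E.
Variables (p : R) (p1 : 1 <= p).
Local Notation LpT := (Lp mu p1).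

Variable K : set LpT.
Hypothesis K_linear : forall l F G, K F -> K G -> K (l *: F + G).
Hypothesis K_closed :
  forall F, (forall e, 0 < e -> exists2 G, K G & `|G - F| < e) -> K F.

Let p0 : 0 < p. Proof. by rewrite (lt_le_trans ltr01). Qed.
Let pge0 : 0 <= p. Proof. exact: ltW. Qed.

(** Membership in K for plain functions, which can be combined pointwise, unlike the
    classes that are the elements of K. *)
Definition represented (f : T -> R) : Prop :=
  exists2 F : LpT, K F & (F : T -> R) = f %[ae mu].

Lemma represented_linear l f g :
  represented f -> represented g -> represented (fun x => l * f x + g x).
Proof.
move=> [F KF Ff] [G KG Gg]; exists (l *: F + G); first exact: K_linear.
apply: (filter_app _ _ (Lp_addE (l *: F) G)).
apply: (filter_app _ _ (Lp_scaleE l F)).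
apply: (filter_app _ _ Ff); apply: (filter_app _ _ Gg).
by apply: filterE => x /(_ I) <- /(_ I) <- /(_ I) + /(_ I) + _ => <- <-.
Qed.

(** The p-th power of |f_n - f| is dominated by that of f, so that f_n tends to f in
    L^p by dominated convergence. The hypothesis covers both the indicators of an
    increasing sequence of sets and the simple functions below a given function. *)
Lemma represented_limit (f : T -> R) (f_ : nat -> T -> R) :
  measurable_fun setT f -> finite_norm mu p%:E f ->
  (forall n, measurable_fun setT (f_ n)) ->
  (forall n x, 0 <= f_ n x <= f x) ->
  (forall x, f_ n x @[n --> \oo] --> f x) ->
  (forall n, represented (f_ n)) -> represented f.
Proof.
move=> mf lf mf_ f_f cvf rf_.
exists (Lp_class p1 mf lf); last exact: Lp_classE.
apply: K_closed => e e0.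
have mfB n : measurable_fun setT (fun x => f_ n x - f x) by exact: measurable_funB.
have : (\int[mu]_x (`|f_ n x - f x| `^ p)%:E @[n --> \oo] --> \int[mu]_x (cst 0 x))%E.
  apply: (@dominated_cvg _ _ _ _ _ _ _ _ (fun x => (`|f x| `^ p)%:E)) => //.
  - by move=> n; exact: measurable_powR_norm.
  - move=> x _; apply/fine_cvgP; split; first exact: nearW.
    rewrite -(powR0 (lt0r_neq0 p0)); apply: (@cvg_powR _ _ p1) => //.
    rewrite -(@normr0 _ R^o) -(subrr (f x)); apply: cvg_norm.
    by apply: cvgB => //; exact: cvg_cst.
  - apply/integrableP; split; first exact: measurable_powR_norm.
    under eq_integral do rewrite gee0_abs ?lee_fin ?powR_ge0//.
    exact: finite_norm_integral lf.
  - move=> n x _; rewrite gee0_abs ?lee_fin ?powR_ge0// ge0_ler_powR ?nnegrE//.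
    have /andP[h0 h1] := f_f n x.
    rewrite distrC !ger0_norm ?subr_ge0//; last exact: le_trans h1.
    by rewrite lerBlDr lerDl.
rewrite integral0 => /fine_cvgP[fin /cvgrPdist_lt].
have e20 : 0 < e / 2 by rewrite divr_gt0.
move=> /(_ _ (powR_gt0 p e20)) /(filterI fin)/filter_ex[n [/= fn]].
rewrite sub0r normrN ger0_norm; last first.
  by rewrite fine_ge0// integral_ge0// => x _; rewrite lee_fin powR_ge0.
rewrite -lte_fin fineK// => /ltW/(Lnorm_leP _ p1 _ (ltW e20)) hn.
have [G KG Gf] := rf_ n; exists G => //.
rewrite -lte_fin Lp_normB (@Lnorm_ae_eq _ _ _ _ _ _ (fun x => f_ n x - f x))//.
- by rewrite (le_lt_trans hn)// lte_fin ltr_pdivrMr// ltr_pMr// ltr1n.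
- by apply: measurable_funB; exact: measurable_Lp.
- apply: (filter_app _ _ (Lp_classE p1 mf lf)); apply: (filter_app _ _ Gf).
  by apply: filterE => x /(_ I) -> /(_ I) ->.
Qed.

Variable Pi : set (set T).
Hypothesis Pi_setI : setI_closed Pi.
Hypothesis Pi_setT : Pi setT.
Hypothesis Pi_generates : measurable = <<s Pi >>.
Hypothesis Pi_represented : forall A, Pi A -> represented \1_A.

(** The pi-lambda theorem: the sets whose indicator is represented are stable under
    proper differences because K is a subspace, and under increasing unions because
    K is closed and the measure is finite. *)
Lemma represented_indic A : measurable A -> represented \1_A.
Proof.
pose H : set (set T) := [set A | measurable A /\ represented \1_A].
have PiH : Pi `<=` H.
  move=> B PiB; split; last exact: Pi_represented.
  by rewrite Pi_generates; exact: sub_sigma_algebra.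
suff : <<s Pi >> `<=` H by rewrite -Pi_generates => + mA => /(_ A mA)[].
apply: lambda_system_subset => //; split => //.
- exact: PiH.
- move=> A' B BA [mA' rA'] [mB rB]; split; first exact: measurableD.
  rewrite (_ : \1_(A' `\` B) = fun x => -1 * \1_B x + \1_A' x).
    exact: represented_linear.
  apply/funext => x; rewrite mulN1r !indicE in_setD.
  have [xB|xB] := boolP (x \in B); last by rewrite oppr0 add0r andbT.
  by rewrite andbF (mem_set (BA _ (set_mem xB))) addNr.
- move=> F ndF HF.
  have mF : measurable (\bigcup_i F i).
    by apply: bigcupT_measurable => i; have [] := HF i.
  split => //; apply: (@represented_limit _ (fun n => \1_(F n))) => //.
  - exact: finite_norm_indic.
  - by move=> n; apply: measurable_indic; have [] := HF n.
  - move=> n x; rewrite !indicE ler0n/= ler_nat.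
    have [/set_mem xF|//] := boolP (x \in F n).
    by rewrite (mem_set (_ : (\bigcup_i F i) x))//; exists n.
  - move=> x; have [/set_mem[n _ Fnx]|xF] := boolP (x \in \bigcup_i F i).
      apply: (@cvg_trans _ (cst (1 : R) @ \oo)); last first.
        by rewrite indicE mem_set; [exact: cvg_cst|exists n].
      apply: near_eq_cvg; exists n => // m /= nm; rewrite indicE mem_set//.
      by have /subsetPset := ndF _ _ nm; exact.
    rewrite (_ : (fun n => _) = cst (\1_(\bigcup_i F i) x)); first exact: cvg_cst.
    apply/funext => n; rewrite /= !indicE (negbTE xF) memNset// => Fnx.
    by move: xF; rewrite mem_set//; exists n.
  - by move=> n; have [] := HF n.
Qed.

Lemma represented_nnsfun (f : {nnsfun T >-> R}) : represented f.
Proof.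
(* K contains 0 because it contains the indicator of the whole space. *)
have r0 : represented (fun=> 0).
  have := represented_linear (-1) (Pi_represented Pi_setT) (Pi_represented Pi_setT).
  by congr represented; apply/funext => x; rewrite mulN1r addNr.
suff rs (s : seq R) : represented (fun x => \sum_(y <- s) y * \1_(f @^-1` [set y]) x).
  rewrite (_ : (f : T -> R) = fun x =>
    \sum_(y <- finmap.enum_fset (fset_set (range f))) y * \1_(f @^-1` [set y]) x)//.
  by apply/funext => x; rewrite fimfunE fsbig_finite.
elim: s => [|y s ih].
  by under eq_fun do rewrite big_nil.
under eq_fun do rewrite big_cons.
by apply: represented_linear => //; exact: represented_indic.
Qed.

Lemma represented_ge0 (f : T -> R) : measurable_fun setT f ->
  (forall x, 0 <= f x) -> finite_norm mu p%:E f -> represented f.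
Proof.
move=> mf f0 lf.
have mEf : measurable_fun setT (EFin \o f) by exact/measurable_EFinP.
pose f_ := nnsfun_approx measurableT mEf.
have cvgf x : f_ n x @[n --> \oo] --> f x.
  have := @cvg_nnsfun_approx _ _ _ _ measurableT _ mEf (fun x _ => f0 x) x I.
  by move=> /fine_cvgP[].
apply: (@represented_limit _ (fun n => f_ n)) => //; last first.
  by move=> n; exact: represented_nnsfun.
move=> n x; rewrite fun_ge0/= -(cvg_lim _ (cvgf x))//.
apply: nondecreasing_cvgn_le; last exact: cvgP (cvgf x).
by move=> m k /(nd_nnsfun_approx measurableT mEf)/lefP; exact.
Qed.

Lemma closed_subspace_pi_system_full F : K F.
Proof.
have mF := measurable_Lp F; have lF := finite_norm_Lp F.
have rp : represented F^\+.
  apply: represented_ge0; [exact: measurable_funrpos|exact: funrpos_ge0|].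
  apply: finite_norm_le lF => //; first exact: measurable_funrpos.
  by move=> x; rewrite ger0_norm// ge_max ler_norm normr_ge0.
have rn : represented F^\-.
  apply: represented_ge0; [exact: measurable_funrneg|exact: funrneg_ge0|].
  apply: finite_norm_le lF => //; first exact: measurable_funrneg.
  by move=> x; rewrite ger0_norm// ge_max -normrN ler_norm normr_ge0.
have [F' KF' F'F] := represented_linear (-1) rn rp.
rewrite (_ : F = F')//; apply/esym/ae_eq_Lp.
apply: filterS F'F => x /[apply] ->.
by rewrite mulN1r addrC -[in RHS](funrposBneg F).
Qed.

End Lp_density.

(** * The Borel sigma-algebra of the path space *)

Section unit_interval_topology.
Context {R : realType}.

(** [0,1] as a type of its own is the image of the segment of R under the clamping
    map. *)
Lemma compact_unit_itv : compact [set: unit_itv R].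
Proof.
pose c (x : R) : R := Num.min 1 (Num.max 0 x).
have c01 x : c x \in (`[0%R, 1%R]%classic : set R).
  rewrite inE/= in_itv/= /c le_min ler01 le_max lexx/=.
  by rewrite ge_min lexx.
pose f (x : R) : unit_itv R := exist _ (c x) (c01 x).
have cf : continuous f.
  apply: continuous_comp_initial => x /=.
  rewrite (_ : set_val \o f = c)//.
  apply: continuous_min; first exact: cvg_cst.
  apply: continuous_max; first exact: cvg_cst.
  exact: cvg_id.
rewrite (_ : [set: _] = f @` `[0, 1]).
  apply: continuous_compact; last exact: segment_compact.
  exact: continuous_subspaceT.
apply/seteqP; split => // x _; exists (set_val x).
  exact: set_valP.
apply: val_inj => /=; rewrite /c.
have := set_valP x; rewrite /= in_itv/= => /andP[x0 x1].
by rewrite (max_idPr x0) (min_idPr x1).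
Qed.

Lemma cover_compact_unit_itv : cover_compact [set: unit_itv R].
Proof.
pose T : pseudoPMetricType R := HB.pack (unit_itv R)
  (isPointed.Build (unit_itv R) (unit_itv0 R)).
by have := compact_unit_itv; rewrite (@compact_cover T).
Qed.

Lemma second_countable_unit_itv : @second_countable (unit_itv R).
Proof.
pose T : pseudoPMetricType R := HB.pack (unit_itv R)
  (isPointed.Build (unit_itv R) (unit_itv0 R)).
exact: (@compact_second_countable R T compact_unit_itv).
Qed.

End unit_interval_topology.

(** An enumeration of a countable basis, with the empty set at the integers that are
    not the code of a basic set. *)
Lemma second_countable_seq (T : topologicalType) : @second_countable T ->
  exists e : nat -> set T, (forall n, open (e n)) /\
    forall x U, nbhs x U -> exists2 n, e n x & e n `<=` U.
Proof.
move=> [B /countable_injP[f finj] [Bo Bb]].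
pose e n := \bigcup_(U in [set U | B U /\ f U = n]) U.
have eE U : B U -> e (f U) = U.
  move=> BU; apply/seteqP; split => [x [V [BV fVU] Vx]|x Ux]; last by exists U.
  by rewrite -(finj _ _ _ _ fVU)//; exact: mem_set.
exists e; split => [n|x U xU].
  by apply: bigcup_open => U [/Bo].
have [V [BV Vx] VU] := Bb x U xU.
by exists (f V); rewrite eE.
Qed.

Section open_sets_of_paths.
Context {R : realType} {M : pseudoPMetricType R}.
Variable x0 : M.
Hypothesis M_compact : compact [set: M].
Variable G : set (set (path_space R x0)).
Local Notation PG := (g_sigma_algebraType G).
Hypothesis G_eval : forall s (C : set M), closed C ->
  measurable ([set g : path_space R x0 | C (g s)] : set PG).

(** It is enough that g s lies in C for one time s in J from each basic open set that
    meets J: the times in J where an exceptional path g is outside C form a nonempty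
    open set, which contains a basic one. *)
Lemma measurable_confined (J : set (unit_itv R)) (C : set M) :
  open J -> closed C ->
  measurable ([set g : path_space R x0 | forall s, J s -> C (g s)] : set PG).
Proof.
move=> Jo Cc.
have [e [eo eb]] := second_countable_seq (@second_countable_unit_itv R).
pose N : set nat := [set n | e n `&` J !=set0].
have /choice[pt hpt] : forall n, exists s, N n -> (e n `&` J) s.
  move=> n; have [[s ?]|nN] := pselect (N n); first by exists s.
  by exists (unit_itv0 R).
rewrite (_ : [set g | _] =
    \bigcap_(n in N) [set g : path_space R x0 | C (g (pt n))]).
  by apply: bigcap_measurableType => // n _; exact: G_eval.
apply/seteqP; split => g /= hg.
  by move=> n Nn; apply: hg; have [] := hpt n Nn.
move=> s Js; apply: contrapT => nC.
have nb : nbhs s (J `&` g @^-1` ~` C).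
  apply: open_nbhs_nbhs; split => //; apply: openI => //.
  by move/continuousP: (@path_continuous _ _ _ g); apply; exact: closed_openC.
have [n ens enU] := eb _ _ nb.
have Nn : N n by exists s.
have [ept Jpt] := hpt n Nn.
by have [_] := enU _ ept; apply; exact: hg.
Qed.

(** The sets V l below, for finite lists l of pairs of indices of basic open sets of
    [0,1] and M, form a countable family, and O is the union of those that it
    contains. Indeed a path g in O has a uniform e-neighbourhood in O. By continuity
    each time has a basic neighbourhood that g maps into a basic open set whose
    closure has diameter less than e, and finitely many of these neighbourhoods
    cover [0,1]. They define a set V l which contains g, and all the paths in V l
    are uniformly e-close to g. *)
Lemma measurable_open_path (O : set (path_space R x0)) :
  open O -> measurable (O : set PG).
Proof.
move=> Oo.
have [eS [eSo eSb]] := second_countable_seq (@second_countable_unit_itv R).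
have [eM [eMo eMb]] := second_countable_seq (compact_second_countable M_compact).
pose V (l : seq (nat * nat)) : set PG :=
  [set g | forall jk, jk \in l -> forall s, eS jk.1 s ->
    closure (eM jk.2) ((g : path_space R x0) s)].
have mV l : measurable (V l).
  elim: l => [|jk l ih].
    by rewrite (_ : V _ = setT)//; apply/seteqP; split.
  rewrite (_ : V _ = [set g : path_space R x0 |
      forall s, eS jk.1 s -> closure (eM jk.2) (g s)] `&` V l).
    apply: measurableI => //; apply: measurable_confined => //.
    exact: closed_closure.
  apply/seteqP; split => g /=.
    move=> h; split; first by move=> s; apply: h; rewrite mem_head.
    by move=> k kl; apply: h; rewrite in_cons kl orbT.
  by move=> [h h'] k; rewrite in_cons => /predU1P[->//|]; exact: h'.
rewrite (_ : O = \bigcup_l (V l `&` [set _ | V l `<=` O])).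
  apply: countable_bigcupT_measurable => // l.
  have [VO|nVO] := pselect (V l `<=` O).
    by rewrite (_ : [set _ | _] = setT) ?setIT//; apply/seteqP; split.
  by rewrite (_ : [set _ | _] = set0) ?setI0//; apply/seteqP; split.
apply/seteqP; split => [g Og|g [l _ [/[swap]]]]; last exact.
have [U Uo UE] := Oo.
have /uniform_nbhs[E [entE EOsub]] : nbhs (path_fun g : {uniform unit_itv R -> M}) U.
  apply: open_nbhs_nbhs; split => //.
  by rewrite -UE in Og.
move: entE; rewrite -entourage_ballE => -[e /= e0 Esub].
have e40 : 0 < e / 4 by rewrite divr_gt0.
pose D : set (nat * nat) := [set jk |
  (forall s, eS jk.1 s -> eM jk.2 (g s)) /\
  forall y z, closure (eM jk.2) y -> closure (eM jk.2) z -> ball y e z].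
have [l lD lcover] : finite_subset_cover D (fun jk => eS jk.1) [set: unit_itv R].
  apply: cover_compact_unit_itv => // s _.
  have [k gsk kball] := eMb _ _ (nbhsx_ballx (g s) _ e40).
  have [j js jk] : exists2 j, eS j s & eS j `<=` g @^-1` eM k.
    apply: eSb; apply: (@path_continuous _ _ _ g).
    by apply: open_nbhs_nbhs; split.
  exists (j, k) => //; split => // y z ky kz.
  have clo w : closure (eM k) w -> ball (g s) (e / 4 + e / 4) w.
    move=> /(_ _ (nbhsx_ballx w _ e40))[v [kv wv]].
    by apply: ball_triangle (kball _ kv) (ball_sym wv).
  have -> : e = (e / 4 + e / 4) + (e / 4 + e / 4) by lra.
  by apply: ball_triangle (clo _ kz); apply: ball_sym; exact: clo.
exists (finmap.enum_fset l) => //; split => /=.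
  move=> jk /lD/set_mem[+ _] s js; move=> /(_ s js).
  exact: subset_closure.
move=> h Vh; rewrite -UE; apply: EOsub => s _; apply: Esub.
have [jk /= jkl js] := lcover s I.
have /set_mem[hg hball] := lD _ jkl.
by apply: hball; [apply: subset_closure; exact: hg|exact: Vh js].
Qed.

End open_sets_of_paths.

Section cylinders.
Context {R : realType} {M : pseudoPMetricType R}.
Variable x0 : M.
Local Notation paths := (borel (path_space R x0)).

Definition cylinders : set (set paths) :=
  [set Z | exists (T : time_partition R)
    (A : set ((size (times T)).-tuple (borel M))), measurable A /\
    Z = @eval_times R M x0 T @^-1` A].

(** Two cylinders over partitions T and T' are cylinders over a common refinement. *)
Lemma cylinders_setI : setI_closed cylinders.
Proof.
move=> _ _ [T [A [mA ->]]] [T' [A' [mA' ->]]].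
have [T'' [TT'' TT2]] := partition_ub T T'.
exists T'', (@restrict_times _ _ x0 T T'' @^-1` A `&`
             @restrict_times _ _ x0 T' T'' @^-1` A').
split.
  by apply: measurableI; rewrite -[X in measurable X]setTI;
    apply: measurable_restrict_times.
by apply/seteqP; split => g /=; rewrite (restrict_eval_times g TT'')
  (restrict_eval_times g TT2).
Qed.

Lemma cylinders_setT : cylinders setT.
Proof. by have [T] := @partition_inhabited R; exists T, setT. Qed.

Lemma cylinders_measurable (Z : set paths) : cylinders Z -> measurable Z.
Proof.
move=> [T [A [mA ->]]]; rewrite -[X in measurable X]setTI.
exact: measurable_eval_times.
Qed.

(** The time 0 belongs to no partition, but all paths start at x0, so that an event
    about this time is either impossible or certain. *)
Lemma cylinders_eval (s : unit_itv R) (A : set (borel M)) : measurable A ->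
  <<s cylinders >> [set g : path_space R x0 | A (g s)].
Proof.
move=> mA.
have [s0|s0] := leP (set_val s : R) 0.
  have sE : s = unit_itv0 R.
    apply: val_inj; apply/eqP; rewrite eq_le s0/=.
    by have := set_valP s; rewrite /= in_itv/= => /andP[].
  have [Ax|nAx] := pselect (A x0).
    rewrite (_ : [set g | _] = setT).
      by apply: sub_sigma_algebra; exact: cylinders_setT.
    by apply/seteqP; split => // g _ /=; rewrite sE path_start.
  rewrite (_ : [set g | _] = set0); first exact: sigma_algebra0.
  by apply/seteqP; split => // g /=; rewrite sE path_start.
apply: sub_sigma_algebra.
have ts : path <%R (0 : R) (map set_val [:: s]) by rewrite /= s0.
exists (TimePartition ts isT), ((fun x => tnth x ord0) @^-1` A); split.
  by rewrite -[X in measurable X]setTI; exact: measurable_tnth.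
by apply/seteqP; split => g /=; rewrite tnth_mktuple.
Qed.

Lemma borel_path_space_cylinders : compact [set: M] ->
  (measurable : set (set paths)) = <<s cylinders >>.
Proof.
move=> Mc; apply/seteqP; split; last first.
  apply: smallest_sub; first exact: sigma_algebra_measurable.
  exact: cylinders_measurable.
apply: smallest_sub; first exact: smallest_sigma_algebra.
move=> O Oo; apply: (measurable_open_path Mc) => // s C Cc.
apply: cylinders_eval; rewrite -(setCK C); apply: measurableC.
by apply: sub_sigma_algebra; exact: closed_openC.
Qed.

End cylinders.
Arguments cylinders {R M} x0 _.

(** * The colimit property of the Wiener space *)

Theorem theorem3p2 (R : realType) (M : pseudoPMetricType R) (n : nat)
    (g : closed_riemannian_manifold R M n) (x0 : M)
    (mu : {measure set (borel M) -> \bar R}) (hmu : is_riemannian_volume g mu)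
    (q : R -> M -> M -> R) (hq : is_heat_kernel g mu q)
    (W : probability (borel (path_space R x0)) R) (hW : is_wiener mu q W)
    (P : forall T : time_partition R,
      probability ((size (times T)).-tuple (borel M)) R)
    (hP : forall T : time_partition R, is_fdd mu q x0 (P T))
    (p : R) (p1 : 1 <= p) :
  is_colimit (wiener_cocone hW hP p1).
Proof.
have fin d (T : measurableType d) (Q : probability T R) : (Q setT < +oo)%E.
  by rewrite probability_setT ltry.
apply: colimit_of_dense_cocone.
pose L := wiener_cocone hW hP p1.
apply: (@closed_subspace_pi_system_full _ _ _ W (fin _ _ W) p p1 (approximable L)
  (@approximable_linear _ _ _ L) (@approximable_closed _ _ _ L) (cylinders x0)).
- exact: cylinders_setI.
- exact: cylinders_setT.
- exact: borel_path_space_cylinders (manifold_compact g).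
(* The indicator of a cylinder over T is the pullback of the indicator of its base,
   hence it lies in the image of the cocone map of index T. *)
- move=> _ [T [A [mA ->]]].
  pose F : Lp (P T) p1 :=
    Lp_class p1 (measurable_indic mA) (finite_norm_indic p1 (fin _ _ (P T)) mA).
  exists (eval_star hW hP p1 T F).
    by move=> e e0; exists T, F; rewrite subrr normr0.
  apply: (filter_app _ _ (pullback_funE (eval_times_preserving hW hP T) F)).
  apply: (filter_app _ _ (ae_pullback (eval_times_preserving hW hP T)
    (Lp_classE p1 (measurable_indic mA) (finite_norm_indic p1 (fin _ _ (P T)) mA)))).
  by apply: filterE => h /(_ I) /= e1 /(_ I) /= -> _; rewrite [LHS]e1.
Qed.
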